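(* For every $\varepsilon>0$ there exists $N_0$ such that the following holds. Let $N>N_0$ be an integer, let $F$ be an integer with $1\le \log_2 F< N/12$, and let $\mathcal{F}$ be chosen uniformly at random among all subsets of $\{-1,1\}^N$ of size $|\mathcal{F}|=F$. Then, with probability at least $1-\varepsilon$, we have $$\frac{2}{5}\sqrt{N\left(\log \binom{N}{k}+k\log|\mathcal{F}|\right)} <\Phi_k (\mathcal{F})<\frac{5}{2} \sqrt{N\left(\log \binom{N}{k}+k\log|\mathcal{F}|\right)}$$ for every integer $k$ with $2\leq k \leq N/(6\log_2|\mathcal{F}|)$ (simultaneously).
   Context: $\log$ denotes the natural logarithm and $\log_2$ the logarithm to base 2. Definition of the cross-correlation measure $\Phi_k(\mathcal{F})$ of order $k$ of a family $\mathcal{F}\subset\{-1,1\}^N$. For $k$ binary sequences $E_N^{(i)}=(e_1^{(i)},e_2^{(i)},\dots,e_N^{(i)})\in\{-1,1\}^N$, $i=1,\dots,k$, a positive integer $M$ and a $k$-tuple $D=(d_1,\dots,d_k)$ of non-negative integers with $$0\leq d_1\leq d_2\leq \dots \leq d_k< M+d_k\leq N,$$ write $$V_k\left( E_N^{(1)}, \dots , E_N^{(k)},M,D\right) =\sum_{n=1}^{M} e_{n+d_1}^{(1)}e_{n+d_2}^{(2)} \cdots e_{n+d_k}^{(k)}.$$ Let $$\widetilde{C}_k\left( E_N^{(1)}, \dots , E_N^{(k)}\right)=\max_{M,D}\left| V_k\left( E_N^{(1)}, \dots , E_N^{(k)},M,D\right)\right|,$$ where the maximum is over all positive integers $M$ and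 all $k$-tuples $D=(d_1,\dots,d_k)$ of non-negative integers satisfying $0\leq d_1\leq d_2\leq \dots \leq d_k< M+d_k\leq N$, with the additional restriction that if $E_N^{(i)}=E_N^{(j)}$ for some $i\neq j$, then $d_i\neq d_j$. Then $$\Phi_k (\mathcal{F})=\max \widetilde{C}_k\left( E_N^{(1)}, \dots , E_N^{(k)}\right),$$ where the maximum is over all $k$-tuples $(E_N^{(1)},\dots,E_N^{(k)})$ with $E_N^{(i)}\in\mathcal{F}$ for $i=1,\dots,k$ (repetitions allowed). *)

(* Defs.v *)
From mathcomp Require Import all_boot all_order all_algebra.
From mathcomp Require Import boolp reals exp.

Set Implicit Arguments.
Unset Strict Implicit.
Unset Printing Implicit Defensive.
Import Order.TTheory GRing.Theory Num.Theory.
Local Open Scope ring_scope.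

Definition pm1 : finType := seq_sub [:: -1; 1 : int].

Definition binseq (N : nat) : finType := N.-tuple pm1.

(* Positions are counted from 0; the junk value 0 for j >= N is never reached
   under [admissible]. *)
Definition entry (N : nat) (e : binseq N) (j : nat) : int :=
  [seq val x | x <- e]`_j.

(* With 0-based positions the summation range 1 <= n <= M becomes n < M. *)
Definition V (N k : nat) (E : k.-tuple (binseq N)) (M : nat)
    (D : k.-tuple nat) : int :=
  \sum_(n < M) \prod_(i < k) entry (tnth E i) (n + tnth D i)%N.

(* d_1 <= ... <= d_k < M + d_k <= N, where d_k = last 0 D and the strict
   inequality amounts to 0 < M; equal sequences get distinct shifts. *)
Definition admissible (N k : nat) (E : k.-tuple (binseq N)) (M : nat)
    (D : k.-tuple nat) : bool :=
  [&& (0 < M)%N, sorted leq D, (M + last 0%N D <= N)%N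
    & [forall i, forall j, (i != j) && (tnth E i == tnth E j) ==>
                           (tnth D i != tnth D j)]].

(* Admissibility forces M <= N and, for k > 0, every d_i < N, so bounding the
   ranges loses nothing.  The maximum is 0 if no (M, D) is admissible, which
   does not happen for 1 <= k <= N (take M = 1, D = (0, ..., k - 1)). *)
Definition Ctilde (N k : nat) (E : k.-tuple (binseq N)) : nat :=
  \max_(M < N.+1)
    \max_(D : k.-tuple 'I_N | admissible E M (map_tuple val D))
      `|V E M (map_tuple val D)|%N.

Definition Phi (N : nat) (Fam : {set binseq N}) (k : nat) : nat :=
  \max_(E : k.-tuple (binseq N) | all [in Fam] E) Ctilde E.

Definition log2 (R : realType) (x : R) : R := ln x / ln 2.

(* Probability of P for an element drawn uniformly at random from A; it is
   meaningful only for nonempty A. *)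
Definition uniform_prob (R : realType) (T : finType) (A : {set T})
    (P : T -> Prop) : R :=
  #|[set x in A | `[< P x >]]|%:R / #|A|%:R.

Definition typical_size (R : realType) (N k F : nat) : R :=
  Num.sqrt (N%:R * (ln ('C(N, k)%:R) + k%:R * ln (F%:R))).

(* Main.v *)
From HB Require Import structures.
Require Import Defs.
From mathcomp Require Import boolp classical_sets reals topology normedtype sequences exp.
From mathcomp Require Import all_boot all_order all_algebra.
From mathcomp Require Import zify ring lra.

(** A family of [F] sequences of length [N] is modelled by [F] independent uniformly random
    sequences.  A family with [F] members is the image of exactly [F`!] injective [F]-tuples of
    sequences, and at least half of all [F]-tuples are injective because [F ^ 2] is small compared
    with [2 ^ N].  Hence an event has, for a random family, at most twice the probability that it
    has for independent sequences ([uniform_prob_ge]).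

    Write the signs as bits.  Choosing [k] sequences with admissible shifts amounts to choosing a
    set [B] of [k] pairs (sequence, shift), and the product of the [k] signs at place [n] is the
    sign of a linear form over the field with two elements.  For nonempty [B], the vector of the
    [M] linear forms is a surjective linear function of the random bits: the bit that the pair
    with the largest shift contributes at place [r] does not occur at any earlier place, so the
    places can be adjusted from left to right.  A surjective linear image of a uniform vector is
    uniform, so each sum [V] is distributed as a sum of [M] independent signs
    ([card_shifted_sums]).

    Put [L = ln 'C(N, k) + k * ln F], so that the typical size is the square root of [N * L].

    Upper bound.  By Hoeffding's inequality a given sum reaches [5 / 2] times the typical size
    with probability at most [2 * expR (- (25 / 8 * L))].  There are at most [N] values of [M], and
    ['C(F * N, k) <= F ^ k * 'C(N, k) ^ 2] sets [B].  The union bound leaves a power [- 9 / 8] of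
    ['C(N, k)], which is at most of order [N ^ (- 9 / 4)] and can be summed over [M] and [k].

    Lower bound.  Take [M] close to [3 / 5 * N], use one fixed sequence with shift [0], and let a
    set [A] of [k - 1] pairs with shifts at most [N - M] range over the other sequences.  For
    different [A] and [A'], the products over [A] and over [A'] differ by the product over the
    symmetric difference, which is a uniform sign vector that does not involve the fixed sequence;
    the fixed sequence contributes an independent uniform factor to both.  The two sums are
    therefore exactly independent ([card_shifted_sums_pair]).  If there are [K] sets [A] and [p] is
    the probability that a sum of [M] independent signs exceeds [2 / 5] times the typical size,
    then by Chebyshev's inequality no sum exceeds this bound with probability at most
    [(K * p)^-1] ([second_moment]).  Comparison with the central binomial coefficient bounds [p]
    from below, and [ln (K * p)] turns out to be at least [ln N / 10 + k / 20 - 16]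
    ([lower_tail_estimate]), so the exceptional probabilities can be summed over [k]. *)

Set Implicit Arguments.
Unset Strict Implicit.
Unset Printing Implicit Defensive.
Import Order.TTheory GRing.Theory Num.Theory.
Import numFieldNormedType.Exports.
Local Open Scope ring_scope.

(** * Binomial coefficients and the exponential *)

Lemma fact_double_ge (j : nat) : (2 ^ j * j`! <= (2 * j)`!)%N.
Proof.
elim: j => [//|j IH]; rewrite mulnS !factS expnS.
apply: (@leq_trans ((2 * j).+2 * (2 * j)`!)); last by rewrite leq_mul2l leq_pmull ?orbT.
apply: (@leq_trans ((2 * j).+2 * (2 ^ j * j`!))); last by rewrite leq_mul2l IH orbT.
by nia.
Qed.

(** Compare the power series term by term: the odd terms on the left cancel, and
    [(2 * j)`!] is at least [2 ^ j * j`!]. *)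
Lemma cosh_le_expR_sqr (R : realType) (a : R) :
  expR a + expR (- a) <= 2 * expR (a ^+ 2 / 2).
Proof.
pose c i : R := exp_coeff a i + exp_coeff (- a) i.
have c_odd j : c (2 * j).+1 = 0.
  by rewrite /c /exp_coeff/= exprNn -signr_odd /= oddM/= expr1; ring.
have c_even j : c (2 * j)%N = 2 * (a ^+ (2 * j) / (2 * j)`!%:R).
  by rewrite /c /exp_coeff/= exprNn -signr_odd oddM/= expr0 mul1r; ring.
have c_even_ge0 j : 0 <= c (2 * j)%N.
  by rewrite c_even mulr_ge0// divr_ge0// exprM exprn_ge0// sqr_ge0.
have c_ge0 i : 0 <= c i.
  have [o|e] := boolP (odd i).
    by rewrite -(odd_double_half i) o add1n -mul2n c_odd.
  by rewrite -(odd_double_half i) (negbTE e) add0n -mul2n.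
have c_even_le j : c (2 * j)%N <= 2 * exp_coeff (a ^+ 2 / 2) j.
  rewrite c_even ler_wpM2l// /exp_coeff/= exprM expr_div_n -mulrA.
  rewrite ler_wpM2l ?(exprn_ge0 _ (sqr_ge0 a))//.
  rewrite -invfM lef_pV2 ?posrE ?mulr_gt0 ?ltr0n ?fact_gt0 ?exprn_gt0//.
  by rewrite -natrX -natrM ler_nat fact_double_ge.
have sum_le n : \sum_(0 <= i < 2 * n) c i <= 2 * expR (a ^+ 2 / 2).
  apply: (@le_trans _ _ (2 * series (exp_coeff (a ^+ 2 / 2)) n)).
    elim: n => [|n IH]; first by rewrite muln0 /series/= !big_geq ?mulr0.
    rewrite mulnS /series/= !big_nat_recr//= c_odd addr0 mulrDr.
    by rewrite lerD// c_even_le.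
  rewrite ler_wpM2l//; apply: nondecreasing_cvgn_le.
    apply: nondecreasing_series => i _ _; rewrite /exp_coeff/= divr_ge0// exprn_ge0//.
    by rewrite divr_ge0// sqr_ge0.
  exact: is_cvg_series_exp_coeff.
have cv (x : R) : (series (exp_coeff x) @ \oo --> expR x)%classic.
  exact: is_cvg_series_exp_coeff.
apply: (cvgr_to_le (cvgD (cv a) (cv (- a)))).
apply: nearW => n; apply: le_trans (sum_le n).
change (\sum_(0 <= i < n) exp_coeff a i + \sum_(0 <= i < n) exp_coeff (- a) i <=
  \sum_(0 <= i < 2 * n) c i).
rewrite -big_split/= mul2n -addnn (big_cat_nat (leq0n n) (leq_addr n n))/=.
by rewrite lerDl sumr_ge0.
Qed.

(** The exponent [5 / 2] instead of the [2] of the linear approximation pays for the range: with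
    [2] the inequality fails for every positive [y]. *)
Lemma one_sub_ge_expR (R : realType) (y : R) : 0 <= y <= 11 / 20 ->
  (1 + y) * expR (- (5 / 2 * y)) <= 1 - y.
Proof.
move=> /andP[y0 y1]; rewrite expRN ler_pdivrMr ?expR_gt0//.
(* [expR (5 / 2 * y)] is the tenth power of [expR s], hence at least that of [1 + s]. *)
pose s := y / 4.
have ys : y = 4 * s by rewrite /s; field.
have s0 : 0 <= s by rewrite /s; lra.
have e1 : (1 + s) ^+ 10 <= expR (5 / 2 * y).
  have -> : 5 / 2 * y = 10%:R * s by rewrite ys; field.
  by rewrite expRM_natl lerXn2r ?nnegrE ?expR_ge0 ?expR_ge1Dx//; lra.
have e2 : 1 + 10 * s + 45 * s ^+ 2 + 120 * s ^+ 3 <= (1 + s) ^+ 10.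
  rewrite -subr_ge0.
  have -> : (1 + s) ^+ 10 - (1 + 10 * s + 45 * s ^+ 2 + 120 * s ^+ 3) = s ^+ 4 *
    (210 + 252 * s + 210 * s ^+ 2 + 120 * s ^+ 3 + 45 * s ^+ 4 + 10 * s ^+ 5 + s ^+ 6) by ring.
  apply: mulr_ge0; first exact: exprn_ge0.
  have h i : 0 <= s ^+ i by exact: exprn_ge0.
  by have := (h 2, h 3, h 4, h 5, h 6); move=> [[[[? ?] ?] ?] ?]; lra.
apply: (@le_trans _ _ ((1 - y) * (1 + s) ^+ 10)); last by rewrite ler_wpM2l//; lra.
apply: (@le_trans _ _ ((1 - y) * (1 + 10 * s + 45 * s ^+ 2 + 120 * s ^+ 3)));
  last by rewrite ler_wpM2l//; lra.
rewrite -subr_ge0.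
have -> : (1 - y) * (1 + 10 * s + 45 * s ^+ 2 + 120 * s ^+ 3) - (1 + y) =
  s * (2 + 5 * s - 60 * s ^+ 2 - 480 * s ^+ 3) by rewrite ys; ring.
rewrite mulr_ge0//.
have s1 : s <= 11 / 80 by rewrite /s; lra.
have h2 : s ^+ 2 <= 11 / 80 * s by rewrite expr2 ler_wpM2r.
have h3 : s ^+ 3 <= 11 / 80 * s ^+ 2 by rewrite exprS ler_wpM2r// exprn_ge0.
lra.
Qed.

(** This is [4 ^ m / (2 * sqrt m) <= 'C(2 * m, m)], squared; by induction, because
    [(2 * m + 1) ^ 2] exceeds [4 * m * (m + 1)]. *)
Lemma central_bin_ge (m : nat) : (0 < m)%N ->
  ((4 ^ m) ^ 2 <= 4 * m * 'C(2 * m, m) ^ 2)%N.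
Proof.
case: m => // m _; elim: m => [//|m IH].
have e1 : (m.+2 * 'C(2 * m.+2, m.+2) = 2 * (2 * m).+3 * 'C(2 * m.+1, m.+1))%N.
  have h1 := mul_bin_diag (2 * m.+1).+2 m.+1.
  have h2 := mul_bin_down (2 * m.+1).+1 m.+1.
  have h3 : (2 * m.+1).+2 = (2 * m.+2)%N by lia.
  have h4 : ((2 * m.+1).+1 - m.+1 = m.+2)%N by lia.
  have h5 : ((2 * m.+2).-1 = (2 * m.+1).+1)%N by lia.
  rewrite /= h4 in h2; rewrite h3 h5 in h1.
  by rewrite -h1 (mulnC 2 m.+2) -mulnA (mulnCA m.+2) -h2 /=; lia.
have e2 : ((m.+2 ^ 2) * (4 ^ m.+2) ^ 2 <= (m.+2 ^ 2) * (4 * m.+2 * 'C(2 * m.+2, m.+2) ^ 2))%N.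
  have -> : ((m.+2 ^ 2) * (4 * m.+2 * 'C(2 * m.+2, m.+2) ^ 2) =
    4 * m.+2 * (m.+2 * 'C(2 * m.+2, m.+2))^2)%N by ring.
  rewrite e1 (expnS 4 m.+1).
  move: IH; move: ('C(_, _)) (4 ^ m.+1)%N => c p IH.
  have : (4 * m.+2 * (2 * (2 * m).+3 * c) ^ 2 = 4 * m.+2 * (2 * (2 * m).+3) ^ 2 * c ^ 2)%N by ring.
  move=> ->.
  have : (m.+2 ^ 2 * (4 * p) ^ 2 = 16 * m.+2 ^ 2 * p ^ 2)%N by ring.
  move=> ->.
  apply: (@leq_trans (16 * m.+2 ^ 2 * (4 * m.+1 * c ^ 2))); first by rewrite leq_mul2l IH orbT.
  nia.
by move: e2; rewrite leq_pmul2l.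
Qed.

(** Going from ['C(2 * m, m - t)] to ['C(2 * m, m - t - 1)] costs a factor of at least
    [(1 - y) / (1 + y)] with [y = (t + 1) / m]; [one_sub_ge_expR] bounds each factor, and the
    exponents [5 / 2 * y] add up to [5 / 4 * t * (t + 1) / m]. *)
Lemma bin_off_center_ge (R : realType) (m t : nat) : (0 < m)%N ->
  t%:R <= 11 / 20 * m%:R :> R ->
  'C(2 * m, m)%:R * expR (- (5 / 4 * (t * t.+1)%:R / m%:R)) <= 'C(2 * m, m - t)%:R :> R.
Proof.
move=> m0; elim: t => [_|t IH ht].
  by rewrite mul0n mulr0 mul0r oppr0 expR0 mulr1 subn0.
have mR : 0 < m%:R :> R by rewrite ltr0n.
have ht' : t%:R <= 11 / 20 * m%:R :> R by apply: le_trans ht; rewrite ler_nat.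
have tm : (t < m)%N by rewrite -(ltr_nat R); move: ht; rewrite -natr1; lra.
have {}IH := IH ht'.
set y : R := t.+1%:R / m%:R.
have hy : 0 <= y <= 11 / 20 by rewrite divr_ge0//= ler_pdivrMr.
have step : (1 + y) * 'C(2 * m, m - t.+1)%:R >= (1 - y) * 'C(2 * m, m - t)%:R.
  have e := mul_bin_left (2 * m) (m - t.+1).
  have e1 : (m - t.+1).+1 = (m - t)%N by lia.
  have e2 : (2 * m - (m - t.+1) = (m + t.+1))%N by lia.
  rewrite e1 e2 in e.
  have -> : 1 + y = (m + t.+1)%:R / m%:R by rewrite /y natrD; field; rewrite gt_eqF.
  have -> : 1 - y = (m - t.+1)%:R / m%:R by rewrite /y natrB//; field; rewrite gt_eqF.
  rewrite mulrAC [leRHS]mulrAC ler_pM2r ?invr_gt0// -!natrM ler_nat -e leq_mul2r.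
  by apply/orP; right; lia.
have yp : 0 < 1 + y by case/andP: hy; lra.
rewrite -(ler_pM2l yp); apply: le_trans step.
apply: (@le_trans _ _ ((1 + y) * expR (- (5 / 2 * y)) * 'C(2 * m, m - t)%:R)); last first.
  by rewrite ler_wpM2r// one_sub_ge_expR.
rewrite -[leRHS]mulrA ler_wpM2l ?(ltW yp)//.
apply: (@le_trans _ _ (expR (- (5 / 2 * y)) *
    ('C(2 * m, m)%:R * expR (- (5 / 4 * (t * t.+1)%:R / m%:R))))).
  rewrite mulrCA ler_wpM2l// -expRD ler_expR /y !natrM -!natr1.
  rewrite le_eqVlt; apply/orP; left; apply/eqP; field; exact: lt0r_neq0.
by rewrite ler_wpM2l ?expR_ge0.
Qed.

(** Each of the [a] factors [(n - i) / (a - i)] of ['C(n, a)] is at least [n / a]. *)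
Lemma expn_le_bin (n a : nat) : (a <= n)%N -> (n ^ a <= 'C(n, a) * a ^ a)%N.
Proof.
elim: a n => [n _|a IH [|n] an]; [by rewrite bin0 !expn0| by []|].
have [->|a0] := posnP a; first by rewrite bin1 !expn1 muln1.
suff : ((n.+1) ^ a * a ^ a <= ('C(n, a) * a.+1 ^ a) * a ^ a)%N.
  rewrite leq_pmul2r ?expn_gt0 ?a0// => h.
  have -> : ('C(n.+1, a.+1) * a.+1 ^ a.+1 = n.+1 * ('C(n, a) * a.+1 ^ a))%N.
    by rewrite expnS mulnA (mulnC 'C(_, _)) -mul_bin_diag mulnA.
  by rewrite expnS leq_pmul2l.
apply: (@leq_trans (n ^ a * a.+1 ^ a)).
  by rewrite -!expnMn leq_exp2r//; nia.
by rewrite -mulnAC leq_pmul2r ?expn_gt0// IH.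
Qed.

(** The binomial coefficient is at most [N ^ k / k`!], and [k ^ k / k`!] is one term of the
    series of [expR k]. *)
Lemma ln_bin_le (R : realType) (N k : nat) : (0 < k <= N)%N ->
  ln ('C(N, k)%:R) <= k%:R * (1 + ln (N%:R / k%:R)) :> R.
Proof.
move=> /andP[k0 kN].
have kR : 0 < k%:R :> R by rewrite ltr0n.
have NR : 0 < N%:R :> R by rewrite ltr0n (leq_trans k0).
have bp : 0 < 'C(N, k)%:R :> R by rewrite ltr0n bin_gt0.
have dp : 0 < N%:R / k%:R :> R by rewrite divr_gt0.
rewrite -ler_expR lnK ?posrE// expRM_natl expRD exprMn lnK ?posrE// -expRM_natl mulr1.
have hk : k%:R ^+ k / k`!%:R <= expR k%:R :> R.
  case: k {bp dp kN} k0 kR => // k _ _.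
  by apply: le_trans (expR_ge1Dxn k (ler0n R k.+1)); rewrite lerDr.
have hb : 'C(N, k)%:R * k`!%:R <= N%:R ^+ k :> R.
  rewrite -natrM -natrX ler_nat bin_ffact ffactE.
  elim: k {k0 kN kR bp dp hk} => [//|k IH].
  by rewrite -ffactE ffactnSr expnSr leq_mul// ?leq_subr// ffactE.
have fp : 0 < k`!%:R :> R by rewrite ltr0n fact_gt0.
apply: (@le_trans _ _ (N%:R ^+ k / k`!%:R)); first by rewrite ler_pdivlMr.
have -> : N%:R ^+ k / k`!%:R = (k%:R ^+ k / k`!%:R) * (N%:R / k%:R) ^+ k :> R.
  by rewrite exprMn exprVn; field; rewrite expf_neq0 gt_eqF//= gt_eqF.
by rewrite ler_wpM2r// exprn_ge0// ltW.
Qed.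

Lemma ffact_ge_expn (N k : nat) : (k <= N)%N -> ((N - k) ^ k <= N ^_ k)%N.
Proof.
have H j : (j <= k -> (N - k) ^ j <= N ^_ j)%N.
  elim: j => [//|j IH jk]; rewrite ffactnSr expnSr leq_mul ?IH//; first exact: ltnW.
  by rewrite leq_sub2l// ltnW.
by move=> _; apply: H.
Qed.

(** Since ['C(F * N, k) * k`!] is at most [(F * N) ^ k], it remains to compare [N ^ k] with
    [N ^_ k * 'C(N, k)]: the first factor is at least [(5 / 6 * N) ^ k] and the second at least
    [6 ^ k]. *)
Lemma bin_mul_le (F N k : nat) : (0 < k)%N -> (6 * k <= N)%N ->
  ('C(F * N, k) <= F ^ k * 'C(N, k) ^ 2)%N.
Proof.
move=> k0 kN.
rewrite -(leq_pmul2r (fact_gt0 k)) bin_ffact.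
apply: (@leq_trans ((F * N) ^ k)).
  elim: (k) => [//|j IH]; rewrite ffactnSr expnSr leq_mul ?leq_subr//.
rewrite expnMn -mulnA leq_mul2l; apply/orP; right.
rewrite expnS expn1 -mulnA bin_ffact.
have kN' : (k <= N)%N by lia.
have c6 : (6 ^ k <= 'C(N, k))%N.
  rewrite -(@leq_pmul2r (k ^ k)) ?expn_gt0 ?k0// -expnMn.
  by apply: leq_trans (expn_le_bin kN'); rewrite leq_exp2r.
apply: (@leq_trans (6 ^ k * (N - k) ^ k)); last by rewrite leq_mul ?ffact_ge_expn.
by rewrite -expnMn leq_exp2r//; lia.
Qed.

Lemma bin2_le_bin (N k : nat) : (2 <= k)%N -> (2 * k <= N)%N -> ('C(N, 2) <= 'C(N, k))%N.
Proof.
case: k => [|[|k]] // _; elim: k => [//|k IH] kN.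
apply: (leq_trans (IH _)); first by lia.
have e := mul_bin_left N k.+2.
rewrite -(@leq_pmul2l k.+3)// e leq_mul2r; apply/orP; right; lia.
Qed.

(** * Shifted sums of random bits *)

(** A surjective homomorphism maps the uniform distribution to the uniform distribution, since its
    fibres are translates of each other. *)
Lemma card_preim_surj_additive (G H : finZmodType) (f : G -> H) (A : {set H}) :
  {morph f : x y / x + y} -> (forall h, exists g, f g = h) ->
  (#|[set g | f g \in A]| * #|H| = #|A| * #|G|)%N.
Proof.
move=> fD fsurj.
have fib h : #|[set g | f g == h]| = #|[set g | f g == 0]|.
  have [g0 fg0] := fsurj h.
  rewrite -[RHS](card_imset _ (addrI g0)); apply: eq_card => g; rewrite !inE.
  have f0 : f 0 = 0 by apply: (addrI (f 0)); rewrite -fD !addr0.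
  apply/eqP/imsetP => [fg|[g' + ->]]; last by rewrite inE => /eqP fg'; rewrite fD fg' addr0.
  exists (g - g0); last by rewrite addrC subrK.
  by rewrite inE -(inj_eq (addIr (f g0))) -fD subrK fg add0r fg0.
have cardA (A' : {set H}) : #|[set g | f g \in A']| = (#|A'| * #|[set g | f g == 0%R]|)%N.
  rewrite -sum1_card (partition_big f (mem A'))/=; last by move=> g; rewrite inE.
  rewrite -sum_nat_const; apply: eq_bigr => h hA.
  rewrite -(fib h) -sum1_card; apply: eq_bigl => g; rewrite !inE.
  by case: eqP => [->|//]; rewrite ?hA ?andbF.
have cardG : #|G| = (#|H| * #|[set g | f g == 0%R]|)%N.
  by rewrite -[X in (X * _)%N]cardsT -cardA; apply: eq_card => g; rewrite !inE.
by rewrite cardA cardG; lia.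
Qed.

(* These provide the structures of finite Z-modules on spaces of configurations and of pairs. *)
HB.saturate finfun_of.
HB.saturate prod.

(** The rows of a configuration are the sequences, [true] standing for the sign [-1]. *)
Definition config (F N : nat) := {ffun 'I_F * 'I_N -> bool}.

(** The value [false] off the range keeps [bit] additive in the configuration. *)
Definition bit (F N : nat) (w : config F N) (j : 'I_F) (i : nat) : bool :=
  oapp (fun i' => w (j, i')) false (insub i).

(** The exponents of the signs that are added up in [V]: the sum, taken in the two-element field,
    ranges over the pairs (sequence, shift). *)
Definition shifted_sums (F N : nat) (B : {set 'I_F * 'I_N}) (M : nat) (w : config F N) :
    {ffun 'I_M -> bool} :=
  [ffun n : 'I_M => \sum_(p in B) bit w p.1 (n + p.2)].

Definition signsum (M : nat) (y : {ffun 'I_M -> bool}) : int := \sum_(n < M) (-1) ^+ y n.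

Lemma bitD (F N : nat) (w w' : config F N) (j : 'I_F) (i : nat) :
  bit (w + w') j i = bit w j i + bit w' j i.
Proof. by rewrite /bit; case: insub => [i'|]; rewrite /= ?ffunE. Qed.

Lemma shifted_sumsD (F N : nat) (B : {set 'I_F * 'I_N}) (M : nat) :
  {morph shifted_sums B M : w w' / w + w'}.
Proof.
move=> w w'; apply/ffunP => n; rewrite !ffunE -big_split/=.
by apply: eq_bigr => p _; rewrite bitD.
Qed.

(** All positions [n + p.2] with [n < M] are valid. *)
Definition fits (F N : nat) (M : nat) (B : {set 'I_F * 'I_N}) : bool :=
  [forall p in B, (M + p.2 <= N)%N].

(** The bit that a pair [p] of [B] with maximal shift contributes at place [r] does not occur at
    the places before [r], since every other pair for the same sequence has a smaller shift.  So the
    places can be given their prescribed values one after the other. *)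
Lemma shifted_sums_surj (F N : nat) (B : {set 'I_F * 'I_N}) (M : nat) :
  B != set0 -> fits M B -> forall y, exists w, shifted_sums B M w = y.
Proof.
move=> /set0Pn[p0 p0B] /forall_inP BM y.
have [p pB pmax] : exists2 p, p \in B & forall q, q \in B -> (q.2 <= p.2)%N.
  case: (arg_maxnP (fun p : 'I_F * 'I_N => val p.2) p0B) => p pB pmax.
  by exists p.
have solve r : (r <= M)%N -> exists w, forall n : 'I_M, (n < r)%N -> shifted_sums B M w n = y n.
  elim: r => [_|r IH rM]; first by exists 0.
  have [w wP] := IH (ltnW rM).
  pose n0 := Ordinal rM.
  have [e|ne] := eqVneq (shifted_sums B M w n0) (y n0).
    exists w => n; rewrite ltnS leq_eqVlt => /orP[/eqP nr|]; last exact: wP.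
    by have -> : n = n0 by apply: val_inj.
  have rp : (r + p.2 < N)%N by have := BM _ pB; lia.
  (* The configuration whose addition flips the bit that [p] contributes at place [r]. *)
  pose u : config F N := [ffun q => q == (p.1, Ordinal rp)].
  have bitu q n : q \in B -> (n <= r)%N -> bit u q.1 (n + q.2) = (n == r) && (q == p).
    move=> qB nr; rewrite /bit; case: insubP => [i _ iE|/=]; last first.
      rewrite -leqNgt => Nle; apply/esym/negbTE/negP => /andP[/eqP nr' /eqP qp].
      by subst q n; have := leq_trans rp Nle; rewrite ltnn.
    rewrite /= ffunE; apply/eqP/andP => [[e1 e2]|[/eqP nr' /eqP qp]]; last first.
      by subst q n; congr pair; apply: val_inj.
    have e3 : val i = (r + p.2)%N by rewrite e2.
    have := pmax _ qB; move: iE; rewrite e3 => iE qp.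
    have nr' : n = r by lia.
    have q2 : q.2 = p.2 by apply: val_inj; move: iE; rewrite nr' => /addnI.
    by rewrite nr' (surjective_pairing q) (surjective_pairing p) e1 q2 !eqxx.
  exists (w + u) => n; rewrite ltnS => nr.
  rewrite shifted_sumsD !ffunE.
  have -> : \sum_(q in B) bit u q.1 (n + q.2) = (n == n0).
    rewrite (bigD1 p)//= big1 ?addr0 => [|q /andP[qB qp]]; rewrite bitu ?eqxx ?andbT//.
    by rewrite (negbTE qp) andbF.
  have [nn0|] := eqVneq n n0.
    by subst n; move: ne; rewrite ffunE; case: (\sum_(_ in _) _); case: (y n0).
  rewrite addr0 => nn0; rewrite -(wP n) ?ffunE//.
  by rewrite ltn_neqAle nr andbT.
have [w wP] := solve M (leqnn M).
by exists w; apply/ffunP => n; apply: wP.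
Qed.

Lemma card_bits (M : nat) : #|{ffun 'I_M -> bool}| = (2 ^ M)%N.
Proof. by rewrite card_ffun card_bool card_ord. Qed.

Lemma card_shifted_sums (F N M : nat) (B : {set 'I_F * 'I_N}) (T : {set {ffun 'I_M -> bool}}) :
  B != set0 -> fits M B ->
  (#|[set w | shifted_sums B M w \in T]| * 2 ^ M = #|T| * #|config F N|)%N.
Proof.
move=> B0 BM; rewrite -card_bits.
exact: (card_preim_surj_additive T (@shifted_sumsD F N B M) (shifted_sums_surj B0 BM)).
Qed.

Definition symdiff (T : finType) (A A' : {set T}) := (A :\: A') :|: (A' :\: A).

Lemma sum_symdiff (T : finType) (A A' : {set T}) (f : T -> bool) :
  \sum_(p in symdiff A A') f p = \sum_(p in A) f p + \sum_(p in A') f p.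
Proof.
rewrite big_mkcond [X in _ = X + _]big_mkcond [X in _ = _ + X]big_mkcond -big_split/=.
apply: eq_bigr => p _; rewrite !inE.
by case: (p \in A); case: (p \in A'); case: (f p).
Qed.

(** The difference of the two vectors is the vector of the symmetric difference of [A] and [A'],
    and can be prescribed without touching row [j0].  Row [j0], shifted by [0], enters both vectors
    in the same way, and then serves to prescribe the first of them. *)
Lemma shifted_sums_pair_surj (F N M : nat) (j0 : 'I_F) (i0 : 'I_N) (A A' : {set 'I_F * 'I_N}) :
  i0 = 0%N :> nat -> (M <= N)%N ->
  {in A, forall p, p.1 != j0} -> {in A', forall p, p.1 != j0} ->
  fits M A -> fits M A' -> A != A' ->
  forall y, exists w,
    (shifted_sums ((j0, i0) |: A) M w, shifted_sums ((j0, i0) |: A') M w) = y.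
Proof.
move=> i00 MN Aj Aj' fA fA' AA' [a b].
have sumE (C : {set 'I_F * 'I_N}) w (n : 'I_M) : {in C, forall p, p.1 != j0} ->
    shifted_sums ((j0, i0) |: C) M w n = bit w j0 n + shifted_sums C M w n.
  move=> Cj; rewrite !ffunE big_setU1/= ?i00 ?addn0//.
  by apply/negP => /Cj; rewrite eqxx.
have [w1 w1P] : exists w1, shifted_sums (symdiff A A') M w1 = a + b.
  apply: shifted_sums_surj.
    apply: contraNneq AA' => /eqP; rewrite setU_eq0 !setD_eq0 => /andP[? ?].
    by rewrite eqEsubset; apply/andP.
  apply/forall_inP => p; rewrite !inE => /orP[]/andP[_ pA].
    exact: (forall_inP fA).
  exact: (forall_inP fA').
pose w : config F N := [ffun q => if q.1 == j0 then
   oapp (fun n : 'I_M => a n + shifted_sums A M w1 n) false (insub (val q.2)) else w1 q].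
have wE (C : {set 'I_F * 'I_N}) : {in C, forall p, p.1 != j0} ->
    shifted_sums C M w = shifted_sums C M w1.
  move=> Cj; apply/ffunP => n; rewrite !ffunE; apply: eq_bigr => p /Cj pj.
  by rewrite /bit; case: insub => //= i; rewrite ffunE/= (negbTE pj).
have w0 (n : 'I_M) : bit w j0 n = a n + shifted_sums A M w1 n.
  rewrite /bit (insubT (fun i => i < N)%N (leq_trans (ltn_ord n) MN))/= ffunE/= eqxx.
  by rewrite valK.
have bb (x : bool) : x + x = 0 by case: x.
exists w; congr pair; apply/ffunP => n; rewrite sumE// wE// w0.
  by rewrite -addrA bb addr0.
have := congr1 (fun f : {ffun _ -> _} => f n) w1P.
by rewrite !ffunE sum_symdiff -addrA => ->; rewrite addrA bb add0r.
Qed.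

Lemma card_shifted_sums_pair (F N M : nat) (j0 : 'I_F) (i0 : 'I_N) (A A' : {set 'I_F * 'I_N})
    (T : {set {ffun 'I_M -> bool}}) :
  i0 = 0%N :> nat -> (M <= N)%N ->
  {in A, forall p, p.1 != j0} -> {in A', forall p, p.1 != j0} ->
  fits M A -> fits M A' -> A != A' ->
  (#|[set w | (shifted_sums ((j0, i0) |: A) M w \in T) &&
             (shifted_sums ((j0, i0) |: A') M w \in T)]| * (2 ^ M * 2 ^ M)
   = #|T| * #|T| * #|config F N|)%N.
Proof.
move=> i00 MN Aj Aj' fA fA' AA'.
have := card_preim_surj_additive (setX T T) _
  (shifted_sums_pair_surj i00 MN Aj Aj' fA fA' AA').
rewrite cardsX card_prod card_bits => <-.
  by congr muln; apply: eq_card => w; rewrite !inE.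
by move=> w w'; rewrite !shifted_sumsD.
Qed.

(** * Sums of random signs *)

Lemma sum_expR_signsum (R : realType) (M : nat) (a : R) :
  \sum_(y : {ffun 'I_M -> bool}) expR (a * (signsum y)%:~R) = (expR a + expR (- a)) ^+ M.
Proof.
have -> : (expR a + expR (- a)) ^+ M = \prod_(n < M) \sum_(b : bool) expR (a * (-1) ^+ b).
  by rewrite prodr_const card_ord big_bool/= expr1 expr0 mulrN mulr1 addrC.
rewrite bigA_distr_bigA/=; apply: eq_bigr => y _.
rewrite /signsum rmorph_sum mulr_sumr expR_sum; apply: eq_bigr => n _.
by rewrite rmorphXn rmorphN1.
Qed.

(** Hoeffding's inequality: both tails are controlled by [expR (a * S) + expR (- a * S)], and
    [a = lam / M] is the best choice. *)
Lemma card_signsum_ge (R : realType) (M : nat) (lam : R) : 0 <= lam -> (0 < M)%N ->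
  #|[set y : {ffun 'I_M -> bool} | lam <= `|signsum y|%:~R]|%:R <=
  2 * 2 ^+ M * expR (- (lam ^+ 2 / (2 * M%:R))).
Proof.
move=> lam0 M0; have MR : 0 < M%:R :> R by rewrite ltr0n.
pose a := lam / M%:R.
have a0 : 0 <= a by rewrite divr_ge0// ltW.
set D := finset _.
have h1 : #|D|%:R * expR (a * lam) <= 2 * (expR a + expR (- a)) ^+ M.
  have e1 := sum_expR_signsum M a; have e2 := sum_expR_signsum M (- a).
  rewrite opprK [X in _ = X ^+ _]addrC in e2.
  rewrite mulr_natl -sumr_const [leRHS]mulr_natl mulr2n -{1}e1 -e2 -big_split/=.
  rewrite [leRHS](bigID (mem D))/= -[leLHS]addr0 lerD//; last first.
    by rewrite sumr_ge0// => y _; rewrite addr_ge0 ?expR_ge0.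
  apply: ler_sum => y; rewrite inE => hy.
  have [s0|s0] := leP 0 (signsum y).
    apply: (@le_trans _ _ (expR (a * (signsum y)%:~R))); last by rewrite lerDl expR_ge0.
    by rewrite ler_expR ler_wpM2l//; move: hy; rewrite ger0_norm.
  apply: (@le_trans _ _ (expR (- a * (signsum y)%:~R))); last by rewrite lerDr expR_ge0.
  by rewrite ler_expR mulNr -mulrN ler_wpM2l//; move: hy; rewrite ltr0_norm// rmorphN.
have h2 : (expR a + expR (- a)) ^+ M <= 2 ^+ M * expR (M%:R * (a ^+ 2 / 2)).
  rewrite expRM_natl -exprMn; apply: lerXn2r; rewrite ?nnegrE ?addr_ge0 ?mulr_ge0 ?expR_ge0//.
  exact: cosh_le_expR_sqr.
rewrite -(ler_pM2r (expR_gt0 (a * lam))) -[leRHS]mulrA -expRD.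
apply: (le_trans h1).
rewrite -[leRHS]mulrA ler_wpM2l//; apply: (le_trans h2).
rewrite ler_wpM2l ?exprn_ge0// ler_expR /a le_eqVlt; apply/orP; left; apply/eqP.
by field; rewrite lt0r_neq0.
Qed.

(** Sign vectors with exactly [m - t] negative entries have sum [2 * t]. *)
Lemma card_signsum_gt (R : realType) (m t : nat) (lam : R) : (t <= m)%N -> lam < (2 * t)%:R ->
  ('C(2 * m, m - t) <= #|[set y : {ffun 'I_(2 * m) -> bool} | (lam < (signsum y)%:~R)%R]|)%N.
Proof.
move=> tm ht.
pose f (A : {set 'I_(2 * m)}) : {ffun 'I_(2 * m) -> bool} := [ffun n => n \in A].
have f_inj : injective f.
  by move=> A A' /ffunP e; apply/setP => n; have := e n; rewrite !ffunE.
rewrite -[X in 'C(X, _)]card_ord -card_draws -(card_imset _ f_inj); apply: subset_leq_card.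
apply/subsetP => _ /imsetP[A + ->]; rewrite !inE => /eqP cA.
have -> : signsum (f A) = (2 * t)%:Z; last by [].
have signE (b : bool) : (-1) ^+ b = 1 - 2 * b%:R :> int by case: b.
rewrite /signsum; under eq_bigr do rewrite signE.
rewrite big_split/= sumr_const card_ord sumrN -mulr_sumr -natr_sum.
have -> : (\sum_(i < 2 * m) f A i = #|A|)%N.
  by rewrite -sum1_card [RHS]big_mkcond/=; apply: eq_bigr => n _; rewrite ffunE; case: (n \in A).
by rewrite cA; lia.
Qed.

(** Chebyshev's inequality, by counting, for the number [X] of the sets [G i] to which a point
    belongs: by pairwise independence the variance of [X] is at most its mean [#|S| * p], and [X]
    deviates from its mean by [#|S| * p] where it vanishes. *)
Lemma second_moment (R : realFieldType) (W I : finType) (S : {set I}) (G : I -> {set W}) (p : R) :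
  0 < p -> (0 < #|S|)%N ->
  {in S, forall i, #|G i|%:R = p * #|W|%:R} ->
  {in S &, forall i j, i != j -> #|G i :&: G j|%:R = p ^+ 2 * #|W|%:R} ->
  #|[set w | [forall i in S, w \notin G i]]|%:R <= #|W|%:R / (#|S|%:R * p).
Proof.
move=> p0 S0 G1 G2.
set K := #|S|%:R : R.
have K0 : 0 < K by rewrite ltr0n.
pose X w : R := \sum_(i in S) (w \in G i)%:R.
have sum_mem (A : {set W}) : \sum_w (w \in A)%:R = #|A|%:R :> R.
  by rewrite -natr_sum -sum1_card [in RHS]big_mkcond.
have sum_const (c : R) : \sum_(i in S) c = K * c by rewrite sumr_const mulr_natl.
have sumX : \sum_w X w = K * p * #|W|%:R.
  rewrite exchange_big/= -mulrA -sum_const; apply: eq_bigr => i iS.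
  by rewrite sum_mem G1.
have sumX2 : \sum_w X w ^+ 2 <= (K * p + K ^+ 2 * p ^+ 2) * #|W|%:R.
  have -> : \sum_w X w ^+ 2 = \sum_(i in S) \sum_(j in S) #|G i :&: G j|%:R.
    rewrite -[RHS](eq_bigr _ (fun i _ => eq_bigr _ (fun j _ => sum_mem _))).
    under [RHS]eq_bigr do rewrite exchange_big/=.
    rewrite [RHS]exchange_big/=; apply: eq_bigr => w _.
    rewrite expr2 mulr_suml; apply: eq_bigr => i _; rewrite mulr_sumr; apply: eq_bigr => j _.
    by rewrite inE -natrM mulnb.
  have -> : (K * p + K ^+ 2 * p ^+ 2) * #|W|%:R =
      \sum_(i in S) (p * #|W|%:R + K * (p ^+ 2 * #|W|%:R)) by rewrite sum_const; ring.
  apply: ler_sum => i iS; rewrite (bigD1 i)//= setIid G1// lerD2l -sum_const.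
  rewrite [leRHS](bigD1 i)//= -[leLHS]add0r lerD ?mulr_ge0 ?exprn_ge0 ?(ltW p0)//.
  by apply: ler_sum => j /andP[jS ji]; rewrite G2// eq_sym.
have key : #|[set w | [forall i in S, w \notin G i]]|%:R * (K * p) ^+ 2 <= K * p * #|W|%:R.
  apply: (@le_trans _ _ (\sum_w (X w - K * p) ^+ 2)).
    rewrite mulr_natl -sumr_const [leRHS](bigID (mem [set w | [forall i in S, w \notin G i]]))/=.
    rewrite -[leLHS]addr0 lerD//; last by rewrite sumr_ge0// => w _; rewrite sqr_ge0.
    apply: ler_sum => w; rewrite inE => /forall_inP h.
    by rewrite /X big1 ?sub0r ?sqrrN// => i /h /negbTE ->.
  under eq_bigr do rewrite sqrrB.
  rewrite big_split/= sumrB sumr_const sumrMnl -mulr_suml sumX -mulr_natl.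
  by have := sumX2; lra.
rewrite ler_pdivlMr ?mulr_gt0// -(ler_pM2r (mulr_gt0 K0 p0)).
by move: key; rewrite expr2 mulrA [leRHS]mulrC.
Qed.

(** * From random sequences to random families *)

Lemma pm1_sign_subproof (b : bool) : (-1) ^+ b \in [:: -1; 1 : int].
Proof. by case: b. Qed.

Definition pm1_sign (b : bool) : pm1 := SeqSub (pm1_sign_subproof b).

Definition seqs (F N : nat) (w : config F N) : {ffun 'I_F -> binseq N} :=
  [ffun j => [tuple pm1_sign (w (j, i)) | i < N]].

Lemma entry_seqs (F N : nat) (w : config F N) (j : 'I_F) (i : nat) : (i < N)%N ->
  entry (seqs w j) i = (-1) ^+ bit w j i.
Proof.
move=> iN; rewrite /entry ffunE (nth_map (pm1_sign false)) ?size_tuple//.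
have -> : i = Ordinal iN by [].
by rewrite -tnth_nth tnth_mktuple /bit insubT.
Qed.

Lemma seqs_inj (F N : nat) : injective (@seqs F N).
Proof.
move=> w w' ww'; apply/ffunP => -[j i].
have := congr1 (fun f : {ffun _ -> binseq N} => tnth (f j) i) ww'.
by rewrite !ffunE !tnth_mktuple => /(congr1 val) /=; case: (w _); case: (w' _).
Qed.

Lemma seqs_surj (F N : nat) (f : {ffun 'I_F -> binseq N}) : exists w, seqs w = f.
Proof.
exists [ffun p => val (tnth (f p.1) p.2) == -1]; apply/ffunP => j; rewrite ffunE.
apply: eq_from_tnth => i; rewrite tnth_mktuple ffunE/=; apply: val_inj => /=.
by case: (tnth (f j) i) => z /=; rewrite !inE => /orP[]/eqP ->.
Qed.

(** For [n] not below [j ^ 2] this is Bernoulli's inequality [1 - j ^ 2 / n <= n ^_ j / n ^ j]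
    for the probability that [j] random elements of an [n]-element set are distinct. *)
Lemma expn_ffact (n j : nat) : (n ^ j * (n - j ^ 2) <= n * n ^_ j)%N.
Proof.
elim: j => [|j IH]; first by rewrite ffactn0 expn0; lia.
rewrite ffactnSr expnSr.
have [h|h] := leqP (j.+1 ^ 2) n; last first.
  by rewrite (eqP (_ : n - j.+1 ^ 2 == 0)%N) ?muln0// subn_eq0 ltnW.
apply: (@leq_trans (n ^ j * (n - j ^ 2) * (n - j))); last by rewrite mulnA leq_mul2r IH orbT.
rewrite -!mulnA leq_mul2l; apply/orP; right.
by move: h; rewrite !expnS !expn0; nia.
Qed.

Lemma card_config (F N : nat) : #|{: config F N}| = ((2 ^ N) ^ F)%N.
Proof. by rewrite card_ffun card_bool card_prod !card_ord mulnC expnM. Qed.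

Lemma card_binseq (N : nat) : #|{: binseq N}| = (2 ^ N)%N.
Proof. by rewrite card_tuple card_seq_sub. Qed.

Lemma card_seqs_eq (F N : nat) (Fam : {set binseq N}) : #|Fam| = F ->
  #|[set w : config F N | injectiveb (seqs w) && (seqs w @: setT == Fam)]| = F`!.
Proof.
move=> cF.
have := card_inj_ffuns_on 'I_F (mem Fam); rewrite cF card_ord ffactnn => <-.
rewrite -(card_imset _ (@seqs_inj F N)).
apply: eq_card => f; rewrite [in RHS]inE; apply/imsetP/andP.
  move=> [w + ->]; rewrite inE => /andP[inj /eqP <-]; split=> //.
  by apply/ffun_onP => j; apply: imset_f.
move=> [/ffun_onP fon inj]; have [w wf] := seqs_surj f; exists w => //.
rewrite inE wf inj/= eqEcard; apply/andP; split.
  by apply/subsetP => _ /imsetP[j _ ->].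
by rewrite card_imset ?cardsT ?card_ord ?cF//; apply/injectiveP.
Qed.

(** Each [F]-element family is the image of [F`!] configurations, and at least half of all
    configurations have distinct rows; whence the factor [2]. *)
Lemma uniform_prob_ge (R : realType) (F N : nat) (P : {set binseq N} -> Prop)
    (bad : {set config F N}) :
  (2 * F ^ 2 <= 2 ^ N)%N ->
  (forall w, injective (seqs w) -> ~ P (seqs w @: setT) -> w \in bad) ->
  1 - 2 * (#|bad|%:R / #|{: config F N}|%:R) <=
  uniform_prob R [set Fam : {set binseq N} | #|Fam| == F] P.
Proof.
move=> FN badP.
set Fams := [set Fam : {set binseq N} | #|Fam| == F].
pose badF := [set Fam in Fams | ~~ `[< P Fam >]].
have cFams : (#|Fams| * F`! = (2 ^ N) ^_ F)%N by rewrite card_draws card_binseq bin_ffact.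
have cbad : (#|badF| * F`! <= #|bad|)%N.
  rewrite -sum_nat_const.
  have -> : (\sum_(Fam in badF) F`! = \sum_(Fam in badF)
     #|[set w : config F N | injectiveb (seqs w) && (seqs w @: setT == Fam)]|)%N.
    by apply: eq_bigr => Fam; rewrite !inE => /andP[/eqP cF _]; rewrite card_seqs_eq.
  rewrite -[leqRHS]sum1_card.
  rewrite (eq_bigr (fun Fam =>
    \sum_(w : config F N | injectiveb (seqs w) && (seqs w @: setT == Fam)) 1)%N); last first.
    by move=> Fam _; rewrite sum1_card; apply: eq_card => w; rewrite !inE.
  under eq_bigr do rewrite big_mkcond.
  rewrite exchange_big/= [leqRHS]big_mkcond/=; apply: leq_sum => w _.
  set img := seqs w @: setT.
  rewrite -big_mkcondr/=.
  have [/injectiveP finj|_] := boolP (injectiveb (seqs w)); last first.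
    by rewrite big1// => Fam /andP[].
  have [/andP[imgF imgP]|imgN] := boolP ((img \in Fams) && ~~ `[< P img >]); last first.
    rewrite big1// => Fam /andP[/=]; rewrite inE => FamF /eqP e.
    by move: imgN; rewrite e FamF.
  rewrite badP//; last exact/asboolPn.
  rewrite (big_pred1 img)// => Fam; rewrite /= eq_sym inE.
  case: eqP => [->|]; last by rewrite andbF.
  by rewrite imgF imgP.
have nR : (2 ^ N)%:R > 0 :> R by rewrite ltr0n expn_gt0.
have half : ((2 ^ N) ^ F <= 2 * (2 ^ N) ^_ F)%N.
  have := expn_ffact (2 ^ N) F; have n0 : (0 < 2 ^ N)%N by rewrite expn_gt0.
  move: FN n0; move: (2 ^ N)%N => n FN n0 h.
  have h2 : (n ^ F * n <= n ^ F * (2 * (n - F ^ 2)))%N by rewrite leq_mul2l; apply/orP; right; lia.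
  by rewrite -(leq_pmul2r n0); lia.
have cF0 : 0 < #|Fams|%:R :> R.
  rewrite ltr0n -(ltn_pmul2r (fact_gt0 F)) mul0n cFams.
  by move: half; case: (_ ^_ _)%N => //; rewrite muln0 leqNgt !expn_gt0.
rewrite /uniform_prob card_config natrX ler_pdivlMr// mulrBl mul1r.
have -> : #|[set Fam in Fams | `[< P Fam >]]|%:R = #|Fams|%:R - #|badF|%:R :> R.
  apply/eqP; rewrite eq_sym subr_eq -natrD; apply/eqP; congr _%:R.
  rewrite -(cardsID [set Fam | `[< P Fam >]] Fams); congr (_ + _)%N.
    by apply: eq_card => Fam; rewrite !inE.
  by apply: eq_card => Fam; rewrite !inE andbC.
rewrite lerD2l lerN2 mulrAC mulrA ler_pdivlMr ?exprn_gt0//.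
rewrite -natrX -!natrM ler_nat.
rewrite -(leq_pmul2r (fact_gt0 F)).
apply: (@leq_trans (#|bad| * (2 ^ N) ^ F)).
  by rewrite mulnAC leq_mul2r cbad orbT.
have -> : (2 * #|Fams| * #|bad| * F`! = #|bad| * (2 * (#|Fams| * F`!)))%N by lia.
by rewrite cFams leq_mul2l half orbT.
Qed.

(** A product of signs is the sign of the sum of the bits. *)
Lemma V_signsum (F N k M : nat) (w : config F N) (q : 'I_k -> 'I_F * 'I_N)
    (E : k.-tuple (binseq N)) (D : k.-tuple nat) :
  injective q -> fits M [set q i | i in 'I_k] ->
  (forall i, tnth E i = seqs w (q i).1) -> (forall i, tnth D i = (q i).2) ->
  V E M D = signsum (shifted_sums [set q i | i in 'I_k] M w).
Proof.
move=> qi /forall_inP fB EE DE; apply: eq_bigr => n _.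
rewrite ffunE (big_imset _ (in2W qi))/=.
rewrite (big_morph (fun b : bool => (-1) ^+ b : int) (id1 := 1) (op1 := *%R)) //; last first.
  by move=> a b; case: a; case: b.
apply: eq_bigr => i _; rewrite EE DE entry_seqs//.
by apply: leq_trans (fB _ (imset_f q (isT : i \in 'I_k))); rewrite ltn_add2r.
Qed.

Lemma sorted_le_last (s : seq nat) (x : nat) :
  sorted leq s -> x \in s -> (x <= last 0%N s)%N.
Proof.
move=> ss xs; have i_lt : (index x s < size s)%N by rewrite index_mem.
have s0 := leq_ltn_trans (leq0n _) i_lt.
rewrite -(nth_index 0%N xs) -nth_last.
by apply: (sorted_leq_nth leq_trans leqnn) => //; rewrite ?inE ?prednK// -ltnS prednK.
Qed.

(** List the pairs of [B] by increasing shift; two pairs for the same sequence have different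
    shifts, so the list is an admissible choice. *)
Lemma signsum_le_Phi (F N k M : nat) (w : config F N) (B : {set 'I_F * 'I_N}) :
  injective (seqs w) -> (0 < M)%N -> (0 < k)%N -> #|B| = k -> fits M B ->
  (`|signsum (shifted_sums B M w)|%N <= Phi (seqs w @: setT) k)%N.
Proof.
move=> finj M0 k0 cB fB.
pose r (p p' : 'I_F * 'I_N) := (p.2 <= p'.2)%N.
pose s := sort r (enum B).
have szs : size s == k by rewrite size_sort -cardE cB.
pose q i := tnth (Tuple szs) i.
have s_uniq : uniq s by rewrite sort_uniq enum_uniq.
have qi : injective q by apply/tuple_uniqP.
have qB : [set q i | i in 'I_k] = B.
  apply/setP => p; rewrite -[RHS]mem_enum -[RHS](mem_sort r) -/s.
  apply/imsetP/idP => [[i _ ->]|ps]; first exact: (mem_tnth i (Tuple szs)).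
  by have /tnthP[i ->] : p \in Tuple szs by []; exists i.
pose E := [tuple seqs w (q i).1 | i < k].
pose D := [tuple (q i).2 | i < k].
have kmax : (k.-1 < k)%N by rewrite prednK.
have MN : (M <= N)%N.
  have := forall_inP fB (q (Ordinal kmax)); rewrite -{1}qB imset_f// => /(_ isT); lia.
have adm : admissible E M (map_tuple val D).
  apply/and4P; split=> //.
  - have -> : map_tuple val D = map_tuple (fun p : 'I_F * 'I_N => val p.2) (Tuple szs).
      by apply: eq_from_tnth => i; rewrite !tnth_map tnth_ord_tuple.
    by rewrite sorted_map; apply: sort_sorted => p p'; apply: leq_total.
  - have : last 0%N (map_tuple val D) \in (0%N :: map_tuple val D) by exact: mem_last.
    rewrite inE => /predU1P[->|/mapP[d /mapP[i _ ->] ->]]; first by rewrite addn0.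
    by apply: (forall_inP fB); rewrite -qB imset_f.
  - apply/forallP => i; apply/forallP => j; apply/implyP => /andP[ij].
    rewrite !tnth_map !tnth_ord_tuple => /eqP/finj e1; apply: contra ij => /eqP/val_inj e2.
    by apply/eqP/qi; rewrite [q i]surjective_pairing e1 e2 -surjective_pairing.
have allE : all [in seqs w @: setT] E.
  by apply/all_tnthP => i; rewrite tnth_mktuple imset_f.
apply: (@leq_trans (Ctilde E)); last exact: (leq_bigmax_cond _ allE).
have MN' : (M < N.+1)%N by rewrite ltnS.
rewrite /Ctilde; apply: (bigop.bigmax_sup (Ordinal MN')) => //; apply: (bigop.bigmax_sup D) => //=.
have -> : V E M (map_tuple val D) = signsum (shifted_sums B M w); last by [].
rewrite -{1}qB; apply: V_signsum => // [|i|i].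
- by rewrite qB.
- by rewrite tnth_mktuple.
- by rewrite !tnth_map tnth_ord_tuple.
Qed.

Lemma natr_bigmax_lt (R : realType) (I : finType) (P : pred I) (f : I -> nat) (lam : R) :
  0 < lam -> (forall i, P i -> (f i)%:R < lam) -> (\max_(i | P i) f i)%:R < lam.
Proof.
move=> lam0 h; apply: (big_ind (fun n : nat => n%:R < lam)) => // a b ha hb.
by rewrite /maxn; case: ifP.
Qed.

(** An admissible choice of sequences and shifts uses [k] different pairs (sequence, shift): this
    is what the condition on equal sequences says. *)
Lemma Phi_lt (R : realType) (F N k : nat) (w : config F N) (lam : R) :
  (0 < k)%N -> injective (seqs w) -> 0 < lam ->
  (forall M (B : {set 'I_F * 'I_N}), (0 < M <= N)%N -> #|B| = k -> fits M B ->
     `|signsum (shifted_sums B M w)|%:~R < lam) ->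
  (Phi (seqs w @: setT) k)%:R < lam.
Proof.
move=> k0 finj lam0 H.
apply: natr_bigmax_lt => // E /all_tnthP Ein; rewrite /Ctilde.
apply: natr_bigmax_lt => // M _; apply: natr_bigmax_lt => // D adm.
have /and4P[M0 sD lD /forallP dist] := adm.
have /fin_all_exists[s sE] i : exists j, tnth E i = seqs w j.
  by have /imsetP[j _ ->] := Ein i; exists j.
pose q i := (s i, tnth D i).
have qi : injective q.
  move=> i j [e1 e2]; apply/eqP; apply: contraT => ij.
  have /forallP/(_ j) := dist i.
  by rewrite ij !sE e1 eqxx/= !tnth_map e2 eqxx.
have Dle i : (tnth D i <= last 0%N [seq val x | x <- D])%N.
  by apply: sorted_le_last => //; rewrite map_f// mem_tnth.
have fq : fits M [set q i | i in 'I_k].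
  apply/forall_inP => _ /imsetP[i _ ->] /=.
  by apply: leq_trans lD; rewrite leq_add2l Dle.
rewrite (V_signsum qi fq sE); last by move=> i; rewrite tnth_map.
have := H M _ _ _ fq; rewrite card_imset// card_ord; apply=> //.
by rewrite M0 -ltnS ltn_ord.
Qed.

(** * Counting the exceptional configurations *)

Lemma card_bigcup_le (T I : finType) (P : pred I) (A : I -> {set T}) :
  (#|\bigcup_(i | P i) A i| <= \sum_(i | P i) #|A i|)%N.
Proof.
apply: (big_ind2 (fun (X : {set T}) n => #|X| <= n)%N) => //; first by rewrite cards0.
by move=> X a Y b hX hY; apply: leq_trans (leq_add hX hY); rewrite cardsU leq_subr.
Qed.

Definition has_large_sum (R : realType) (F N k : nat) (lam : R) : {set config F N} :=
  [set w | [exists M : 'I_N.+1, [exists B : {set 'I_F * 'I_N},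
    [&& (0 < M)%N, #|B| == k, fits M B & lam <= `|signsum (shifted_sums B M w)|%:~R]]]].

(** Union bound over [M] and [B], with Hoeffding's inequality for each pair. *)
Lemma card_has_large_sum (R : realType) (F N k : nat) (lam : R) : (0 < k)%N -> 0 <= lam ->
  #|has_large_sum F N k lam|%:R <=
  N%:R * 'C(F * N, k)%:R * (2 * expR (- (lam ^+ 2 / (2 * N%:R)))) * #|{: config F N}|%:R.
Proof.
move=> k0 lam0.
pose G (M : 'I_N.+1) (B : {set 'I_F * 'I_N}) := [set w : config F N |
  [&& (0 < M)%N, #|B| == k, fits M B & lam <= `|signsum (shifted_sums B M w)|%:~R]].
set e := 2 * expR _; have e0 : 0 <= e by rewrite mulr_ge0 ?expR_ge0.
have cG M B : #|G M B|%:R <=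
    (if (0 < M)%N && (#|B| == k) then e * #|{: config F N}|%:R else 0) :> R.
  case: ifP => [/andP[M0 /eqP cB]|h]; last first.
    have -> : G M B = set0 by apply/setP => w; rewrite !inE andbA h.
    by rewrite cards0.
  have [fB|nfB] := boolP (fits M B); last first.
    have -> : G M B = set0 by apply/setP => w; rewrite !inE (negbTE nfB) !andbF.
    by rewrite cards0 mulr_ge0.
  have B0 : B != set0 by rewrite -card_gt0 cB.
  pose T := [set y : {ffun 'I_M -> bool} | lam <= `|signsum y|%:~R].
  have cT := card_shifted_sums T B0 fB.
  have -> : #|G M B| = #|[set w : config F N | shifted_sums B M w \in T]|.
    by apply: eq_card => w; rewrite !inE M0 cB eqxx fB.
  have p2 : 0 < 2 ^+ M :> R by rewrite exprn_gt0.
  rewrite -(ler_pM2r p2) -natrX -natrM cT natrM natrX mulrAC ler_wpM2r//.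
  apply: le_trans (card_signsum_ge lam0 M0) _.
  rewrite /e mulrAC ler_wpM2r ?exprn_ge0// ler_wpM2l// ler_expR lerN2.
  have MN : (M <= N)%N by rewrite -ltnS.
  have N0 := leq_trans M0 MN.
  rewrite ler_wpM2l ?sqr_ge0// lef_pV2 ?posrE ?mulr_gt0 ?ltr0n//.
  by rewrite ler_wpM2l// ler_nat.
have sub : has_large_sum F N k lam \subset \bigcup_M \bigcup_B G M B.
  apply/fintype.subsetP => w; rewrite inE => /existsP[M /existsP[B h]].
  by apply/bigcupP; exists M => //; apply/bigcupP; exists B => //; rewrite inE.
have union (I : finType) (A : I -> {set config F N}) : #|\bigcup_i A i|%:R <= \sum_i #|A i|%:R :> R.
  by rewrite -natr_sum ler_nat card_bigcup_le.
apply: (@le_trans _ _ #|\bigcup_M \bigcup_B G M B|%:R); first by rewrite ler_nat subset_leq_card.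
apply: le_trans (union _ _) _.
apply: (@le_trans _ _ (\sum_(M : 'I_N.+1)
    (if (0 < M)%N then 'C(F * N, k)%:R * (e * #|{: config F N}|%:R) else 0))).
  apply: ler_sum => M _; apply: le_trans (union _ _) _.
  apply: le_trans (ler_sum _ (fun B _ => cG M B)) _.
  case: ifP => M0; last by rewrite big1.
  rewrite -big_mkcond sumr_const mulr_natl.
  have -> : #|[pred i : {set 'I_F * 'I_N} | true & #|i| == k]| = 'C(F * N, k); last by [].
  rewrite -[F in RHS]card_ord -[N in RHS]card_ord -card_prod -card_draws.
  by apply: eq_card => B; rewrite !inE.
by rewrite big_ord_recl/= add0r sumr_const card_ord -[leLHS]mulr_natl !mulrA.
Qed.

Definition shifts_off (F N : nat) (j0 : 'I_F) (M : nat) : {set 'I_F * 'I_N} :=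
  [set p : 'I_F * 'I_N | (p.1 != j0) && (M + p.2 <= N)%N].

Lemma card_shifts_off (F N : nat) (j0 : 'I_F) (M : nat) : (0 < M <= N)%N ->
  #|shifts_off N j0 M| = (F.-1 * (N - M).+1)%N.
Proof.
move=> /andP[M0 MN].
have -> : shifts_off N j0 M = setX [set~ j0] [set d : 'I_N | (d < (N - M).+1)%N].
  by apply/setP => p; rewrite !inE; congr andb; rewrite ltnS leq_subRL.
rewrite cardsX cardsC1 card_ord; congr muln.
have h : ((N - M).+1 <= N)%N by lia.
have widen_inj : injective (widen_ord h) by move=> x y /(congr1 val) /= /val_inj.
rewrite -[RHS]card_ord -[RHS](card_imset _ widen_inj).
apply: eq_card => d; rewrite inE; apply/idP/imsetP => [dM|[i _ ->]]; last exact: (ltn_ord i).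
by exists (Ordinal dM) => //; apply: val_inj.
Qed.

(** Here [j0] is the fixed sequence and [i0] the shift [0]; the [k] further pairs of [A] avoid
    row [j0], which makes the sums for different [A] independent. *)
Definition no_large_sum (R : realType) (F N k : nat) (j0 : 'I_F) (i0 : 'I_N) (M : nat) (lam : R) :
    {set config F N} :=
  [set w | [forall A : {set 'I_F * 'I_N}, (A \subset shifts_off N j0 M) && (#|A| == k) ==>
    ((signsum (shifted_sums ((j0, i0) |: A) M w))%:~R <= lam)]].

(** The second moment method; the tail probability of a sum of [2 * m] signs is bounded below by
    the probability of the single value [2 * t]. *)
Lemma card_no_large_sum (R : realType) (F N k m t : nat) (j0 : 'I_F) (i0 : 'I_N) (lam : R) :
  i0 = 0%N :> nat -> (0 < m)%N -> (2 * m <= N)%N -> (t <= m)%N -> lam < (2 * t)%:R ->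
  (k <= F.-1 * (N - 2 * m).+1)%N ->
  #|no_large_sum k j0 i0 (2 * m) lam|%:R <= #|{: config F N}|%:R /
    ('C(F.-1 * (N - 2 * m).+1, k)%:R * ('C(2 * m, m - t)%:R / 4 ^+ m)) :> R.
Proof.
move=> i00 m0 mN tm lamt kQ.
pose S := [set A : {set 'I_F * 'I_N} | (A \subset shifts_off N j0 (2 * m)) && (#|A| == k)].
pose T := [set y : {ffun 'I_(2 * m) -> bool} | lam < (signsum y)%:~R].
pose G A := [set w : config F N | shifted_sums ((j0, i0) |: A) (2 * m) w \in T].
have cT : ('C(2 * m, m - t) <= #|T|)%N by exact: card_signsum_gt.
have cT0 : (0 < #|T|)%N by apply: leq_trans cT; rewrite bin_gt0; lia.
pose p : R := #|T|%:R / 4 ^+ m.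
have p4 : 0 < 4 ^+ m :> R by rewrite exprn_gt0.
have p0 : 0 < p by rewrite divr_gt0// ltr0n.
have two4 : (2 ^ (2 * m))%:R = 4 ^+ m :> R by rewrite expnM natrX.
have m2 : (0 < 2 * m <= N)%N by rewrite mN; lia.
have cS : #|S| = 'C(F.-1 * (N - 2 * m).+1, k) by rewrite cards_draws card_shifts_off.
have cS0 : (0 < #|S|)%N by rewrite cS bin_gt0.
have S_j0 A : A \in S -> {in A, forall q, q.1 != j0}.
  by rewrite inE => /andP[/fintype.subsetP sA _] q /sA; rewrite inE => /andP[].
have S_fits A : A \in S -> fits (2 * m) A.
  rewrite inE => /andP[/fintype.subsetP sA _]; apply/forall_inP => q /sA.
  by rewrite inE => /andP[].
have fits0 A : A \in S -> fits (2 * m) ((j0, i0) |: A).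
  move=> AS; apply/forall_inP => q; rewrite !inE => /orP[/eqP ->|]; first by rewrite /= i00 addn0.
  exact: (forall_inP (S_fits _ AS)).
have G1 : {in S, forall A, #|G A|%:R = p * #|{: config F N}|%:R}.
  move=> A AS; have U0 : (j0, i0) |: A != set0 by apply/set0Pn; exists (j0, i0); rewrite setU11.
  have := card_shifted_sums T U0 (fits0 A AS).
  move/(congr1 (fun n => n%:R : R)); rewrite !natrM two4 => h.
  by rewrite /p mulrAC -h mulfK// gt_eqF.
have G2 : {in S &, forall A A', A != A' -> #|G A :&: G A'|%:R = p ^+ 2 * #|{: config F N}|%:R}.
  move=> A A' AS A'S AA'.
  have := card_shifted_sums_pair T i00 mN (S_j0 _ AS) (S_j0 _ A'S) (S_fits _ AS) (S_fits _ A'S) AA'.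
  have -> : [set w | (shifted_sums ((j0, i0) |: A) (2 * m) w \in T) &&
     (shifted_sums ((j0, i0) |: A') (2 * m) w \in T)] = G A :&: G A'.
    by apply/setP => w; rewrite !inE.
  move/(congr1 (fun n => n%:R : R)); rewrite !natrM two4 => h.
  rewrite /p expr_div_n mulrAC expr2 -h expr2 mulfK//.
  by rewrite mulf_neq0// lt0r_neq0.
have := second_moment p0 cS0 G1 G2.
have -> : [set w | [forall A in S, w \notin G A]] = no_large_sum k j0 i0 (2 * m) lam.
  by apply/setP => w; rewrite !inE; apply: eq_forallb => A; rewrite !inE -leNgt.
move/le_trans; apply.
rewrite ler_wpM2l// lef_pV2 ?posrE ?mulr_gt0 ?invr_gt0// ?ltr0n ?bin_gt0//; try lia.
by rewrite cS ler_wpM2l// ler_wpM2r ?invr_ge0 ?(ltW p4)// ler_nat.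
Qed.

(** * Numerical estimates *)

(** The three bounds follow from [9 / 8 <= expR (1 / 8)] and [3 / 4 <= expR (- (1 / 4))]. *)
Lemma expR_numeric_bounds (R : realType) :
  [/\ 2 <= expR (3 / 4) :> R, 5 / 2 <= expR 1 :> R & expR (3 / 4) <= 12 / 5 :> R].
Proof.
pose a : R := expR (1 / 8); pose q := a ^+ 2.
have a1 : 9 / 8 <= a by apply: le_trans (expR_ge1Dx _); lra.
have e34 : expR (3 / 4) = q ^+ 3 by rewrite /q /a -!expRM_natl; congr expR; field.
have e1 : expR 1 = q ^+ 4 by rewrite /q /a -!expRM_natl; congr expR; field.
have q1 : 81 / 64 <= q.
  by rewrite /q expr2; apply: (@le_trans _ _ (9 / 8 * a)); [lra|rewrite ler_wpM2r; lra].
have q2 : 8 / 5 <= q ^+ 2.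
  by rewrite expr2; apply: (@le_trans _ _ (81 / 64 * q)); [lra|rewrite ler_wpM2r; lra].
have q3 : 2 <= q ^+ 3.
  by rewrite exprS; apply: (@le_trans _ _ (81 / 64 * q ^+ 2)); [lra|rewrite ler_wpM2r; lra].
have q4 : 5 / 2 <= q ^+ 4.
  by rewrite exprS; apply: (@le_trans _ _ (81 / 64 * q ^+ 3)); [lra|rewrite ler_wpM2r; lra].
split; rewrite ?e34 ?e1// -e34.
have b1 : 3 / 4 <= expR (- (1 / 4)) :> R by apply: le_trans (expR_ge1Dx _); lra.
have -> : expR (3 / 4) = (expR (- (1 / 4)) ^+ 3)^-1 :> R.
  by rewrite -expRM_natl -expRN; congr expR; field.
have -> : 12 / 5 = (5 / 12)^-1 :> R by field.
rewrite lef_pV2 ?posrE ?exprn_gt0 ?expR_gt0//; last by lra.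
apply: (@le_trans _ _ ((3 / 4) ^+ 3)); first by lra.
by apply: lerXn2r; rewrite ?nnegrE ?expR_ge0//; lra.
Qed.

Lemma ln_le_of_expR (R : realType) (x y : R) : 0 < x -> x <= expR y -> ln x <= y.
Proof. by move=> x0 h; rewrite -ler_expR lnK. Qed.

Lemma ln_ge_of_expR (R : realType) (x y : R) : expR y <= x -> y <= ln x.
Proof. by move=> h; rewrite -ler_expR lnK// posrE (lt_le_trans (expR_gt0 y)). Qed.

Lemma ln_constants (R : realType) :
  [/\ (ln 2 : R) <= 3 / 4, (ln 5 : R) <= 7 / 4 & 3 / 4 <= (ln (12 / 5) : R) <= 1].
Proof.
have [h1 h2 h3] := expR_numeric_bounds R.
split; first exact: ln_le_of_expR.
  apply: ln_le_of_expR => //; have -> : 7 / 4 = 3 / 4 + 1 :> R by field.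
  rewrite expRD; apply: (@le_trans _ _ (2 * expR 1)); first by lra.
  by rewrite ler_wpM2r ?expR_ge0.
by rewrite ln_ge_of_expR//= ln_le_of_expR//; lra.
Qed.

(** In the application [l] is [ln N], and [w] is the logarithm of a number that is at least both
    [12 / 5] and [2 / 5 * N / k].  For bounded [k] the second bound makes [w] almost [l], and the
    tightest case [k = 2] leaves [13 / 20 * l] against [3 / 5 * l].  For [k] up to the square root
    of [N] it still gives [l / 2 - 1], and then the product grows like [k * l].  Beyond that the
    constant bound suffices, because [k] is much larger than [l]. *)
Lemma exponent_estimate (R : realType) (l k w : R) : 300 <= l -> 2 <= k -> 3 / 4 <= w ->
  l - ln k - 1 <= w ->
  l / 10 + k / 20 - 13 <= (33 / 40 * k - 1) * w - 77 / 160 * k - l / 2.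
Proof.
move=> l300 k2 w1 w2.
set P := (_ * w).
have k0 : 0 < k by lra.
have [k16|k16] := leP k 16.
  have lnk : ln k <= 3.
    apply: (@le_trans _ _ (ln (2 ^+ 4))); last first.
      by rewrite lnXn//; have [? _ _] := ln_constants R; lra.
    by rewrite ler_ln ?posrE ?exprn_gt0//; lra.
  have h : 65 / 100 * (l - 4) <= P by apply: ler_pM; lra.
  lra.
have [lk|lk] := leP (ln k) (l / 2).
  have h : 76 / 100 * k * (l / 2 - 1) <= P by apply: ler_pM; lra.
  have h' : 16 * l <= k * l by rewrite ler_wpM2r//; lra.
  have h'' : k * 300 <= k * l by rewrite ler_wpM2l//; lra.
  lra.
have h : 76 / 100 * k * (3 / 4) <= P by apply: ler_pM; lra.
have kl : l * l / 8 <= k.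
  rewrite -[leRHS]lnK ?posrE//.
  apply: (@le_trans _ _ (expR (l / 2))); last by rewrite ler_expR ltW.
  have l0 : 0 <= l / 2 by lra.
  have := expR_ge1Dxn 1 l0; have -> : 2`! = 2%N by [].
  by apply: le_trans; lra.
have h' : 300 * l <= l * l by rewrite ler_wpM2r//; lra.
lra.
Qed.

(** The square of the typical size, divided by [N]. *)
Definition log_count (R : realType) (N k F : nat) : R :=
  ln ('C(N, k)%:R) + k%:R * ln F%:R.

Lemma ln_natr_ge0 (R : realType) (n : nat) : 0 <= ln (n%:R : R).
Proof. by case: n => [|n]; [rewrite ln0|rewrite ln_ge0// ler1n]. Qed.

Lemma log_count_ge0 (R : realType) (N k F : nat) : 0 <= log_count R N k F.
Proof. by rewrite addr_ge0 ?mulr_ge0 ?ln_natr_ge0. Qed.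

Lemma typical_size_sqr (R : realType) (N k F : nat) :
  typical_size R N k F ^+ 2 = N%:R * log_count R N k F.
Proof. by rewrite sqr_sqrtr// mulr_ge0// log_count_ge0. Qed.

Lemma typical_size_ge0 (R : realType) (N k F : nat) : 0 <= typical_size R N k F.
Proof. exact: sqrtr_ge0. Qed.

(** As [ln z <= z - 1], the function [k * (1 + ln (N / k))] lies below its tangent at [k = N / 6],
    which gives [L <= N / 6 * (1 + ln 6 + ln 2)]. *)
Lemma log_count_le_linear (R : realType) (N k F : nat) :
  (0 < k)%N -> (6 * k <= N)%N -> 6 * k%:R * ln F%:R <= N%:R * ln 2 :> R ->
  log_count R N k F <= 5 / 8 * N%:R.
Proof.
move=> k0 kN kF.
have kR : 0 < k%:R :> R by rewrite ltr0n.
have NR : 0 < N%:R :> R by rewrite ltr0n; lia.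
have kNR : 6 * k%:R <= N%:R :> R by rewrite -natrM ler_nat.
have [_ h5 /andP[_ h125]] := ln_constants R.
have h12 : ln 12 <= 11 / 4 :> R.
  have -> : 12 = 12 / 5 * 5 :> R by field.
  by rewrite lnM ?posrE//; lra.
have h62 : ln 12 = ln 6 + ln 2 :> R.
  by have -> : 12 = 6 * 2 :> R by [ring]; rewrite lnM ?posrE.
have hb : ln ('C(N, k)%:R) <= k%:R * (1 + ln (N%:R / k%:R)) :> R by apply: ln_bin_le; lia.
have z0 : 0 < N%:R / (6 * k%:R) :> R by rewrite divr_gt0// mulr_gt0.
have hz : ln (N%:R / k%:R) <= ln 6 + (N%:R / (6 * k%:R) - 1) :> R.
  have -> : N%:R / k%:R = 6 * (1 + (N%:R / (6 * k%:R) - 1)) :> R by field; rewrite gt_eqF.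
  rewrite lnM ?posrE//; last by lra.
  by rewrite lerD2l le_ln1Dx//; lra.
have hk : k%:R * (1 + ln (N%:R / k%:R)) <= k%:R * ln 6 + N%:R / 6 :> R.
  apply: (@le_trans _ _ (k%:R * (ln 6 + N%:R / (6 * k%:R)))); first by rewrite ler_wpM2l//; lra.
  rewrite mulrDr lerD2l le_eqVlt; apply/orP; left; apply/eqP; field.
  by rewrite gt_eqF.
have ln6 : 0 <= ln 6 :> R by rewrite ln_ge0//; lra.
have h6 : 6 * k%:R * ln 6 <= N%:R * ln 6 :> R by rewrite ler_wpM2r.
have h12N : N%:R * ln 6 + N%:R * ln 2 <= N%:R * (11 / 4) :> R by rewrite -mulrDr ler_wpM2l//; lra.
rewrite /log_count; lra.
Qed.

(** With ['C(N, k) <= (e * N / k) ^ k] the count is at most [k * (1 + ln (F * N / k))]; the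
    factor [5] is split off to match the lower bound for the number of shift sets. *)
Lemma log_count_le_mul (R : realType) (N k F : nat) :
  (0 < k <= N)%N -> (0 < F)%N ->
  log_count R N k F <= k%:R * (11 / 4 + ln (F%:R * N%:R / (5 * k%:R))).
Proof.
move=> kN F0; have := ln_bin_le R kN; move/andP: kN => [k0 kN] hb.
have kR : 0 < k%:R :> R by rewrite ltr0n.
have NR : 0 < N%:R :> R by rewrite ltr0n; lia.
have FR : 0 < F%:R :> R by rewrite ltr0n.
have [_ h5 _] := ln_constants R.
have e : ln F%:R + ln (N%:R / k%:R) = ln 5 + ln (F%:R * N%:R / (5 * k%:R)) :> R.
  rewrite -!lnM ?posrE ?divr_gt0 ?mulr_gt0//.
  by congr ln; field; rewrite gt_eqF.
have : k%:R * (1 + ln (N%:R / k%:R)) + k%:R * ln F%:R <=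
   k%:R * (11 / 4 + ln (F%:R * N%:R / (5 * k%:R))) :> R.
  by rewrite -mulrDr ler_wpM2l//; lra.
rewrite /log_count; lra.
Qed.

Lemma central_bin_expR (R : realType) (m N : nat) : (0 < m)%N -> (2 * m <= N)%N ->
  expR (- ((ln N%:R + 1) / 2)) * 4 ^+ m <= 'C(2 * m, m)%:R :> R.
Proof.
move=> m0 mN.
have NR : 0 < N%:R :> R by rewrite ltr0n; lia.
rewrite -(@ler_pXn2r _ 2) ?nnegrE ?mulr_ge0 ?expR_ge0 ?exprn_ge0//.
rewrite exprMn -expRM_natl.
have -> : 2 * - ((ln N%:R + 1) / 2) = - (ln N%:R + 1) :> R by field.
rewrite expRN ler_pdivrMl ?expR_gt0//.
rewrite expRD lnK ?posrE//.
apply: (@le_trans _ _ ((4 * m * 'C(2 * m, m) ^ 2)%:R)).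
  by have := central_bin_ge m0; rewrite -(ler_nat R) !natrX.
rewrite natrM natrX ler_wpM2r ?sqr_ge0//.
have [_ h5 _] := expR_numeric_bounds R.
have h : (2 * m)%:R <= N%:R :> R by rewrite ler_nat.
apply: (@le_trans _ _ (N%:R * (5 / 2))); last by rewrite ler_wpM2l// ltW.
by move: h; rewrite !natrM; have := ler0n R m; lra.
Qed.

Lemma block_length_bounds (R : realType) (N : nat) (m := ((3 * N) %/ 10)%N) : (1000 <= N)%N ->
  [/\ (0 < m)%N, (10 * m <= 3 * N)%N & 299 / 1000 * N%:R <= m%:R :> R].
Proof.
move=> N1000; have lo : (3 * N < 10 * m.+1)%N by rewrite (mulnC 10%N) -ltn_divLR.
split; [by rewrite divn_gt0//; lia|by rewrite mulnC leq_divM|].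
clearbody m.
have N1 : 1000 <= N%:R :> R by rewrite ler_nat.
have : (3 * N)%:R < (10 * m.+1)%:R :> R by rewrite ltr_nat.
by rewrite !natrM -natr1; lra.
Qed.

(** There are at least [F / 2] further sequences and [2 / 5 * N] shifts for each of them. *)
Lemma bin_shifts_ge (R : realType) (N F k m : nat) :
  (2 <= F)%N -> (2 <= k)%N -> (6 * k <= N)%N -> (10 * m <= 3 * N)%N ->
  (k.-1 <= F.-1 * (N - 2 * m).+1)%N /\
  (F%:R * N%:R / (5 * k%:R)) ^+ k.-1 <= 'C(F.-1 * (N - 2 * m).+1, k.-1)%:R :> R.
Proof.
move=> F2 k2 kN mN.
have f2n : (2 * N <= 5 * (N - 2 * m).+1)%N by lia.
set n := (N - 2 * m).+1 in f2n *.
clearbody n.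
have kQ : (k.-1 <= F.-1 * n)%N.
  apply: (@leq_trans n); last by rewrite leq_pmull//; lia.
  lia.
split=> //; set Q := (F.-1 * n)%N in kQ *.
have kR : 0 < k%:R :> R by rewrite ltr0n; lia.
have a0 : 0 < k.-1%:R :> R by rewrite ltr0n; lia.
have k5 : 0 < 5 * k%:R :> R by rewrite mulr_gt0.
have ak : k.-1%:R <= k%:R :> R by rewrite ler_nat leq_pred.
have FR : 2 <= F%:R :> R by rewrite ler_nat.
have f1 : F%:R / 2 <= F.-1%:R :> R.
  have e : F.-1.+1%:R = F%:R :> R by rewrite prednK//; lia.
  by move: e FR; rewrite -natr1; lra.
have f2 : 2 / 5 * N%:R <= n%:R :> R.
  by move: f2n; rewrite -(ler_nat R) !natrM; lra.
have hQ : F%:R * N%:R / 5 <= Q%:R :> R.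
  rewrite /Q natrM; apply: (@le_trans _ _ (F%:R / 2 * (2 / 5 * N%:R))); first by lra.
  by apply: ler_pM; rewrite ?mulr_ge0//; lra.
apply: (@le_trans _ _ ((Q%:R / k.-1%:R) ^+ k.-1)).
  apply: lerXn2r; rewrite ?nnegrE ?divr_ge0 ?mulr_ge0 ?(ltW k5)//.
  rewrite invfM mulrA; apply: ler_pM; rewrite ?divr_ge0 ?invr_ge0 ?mulr_ge0//.
  by rewrite lef_pV2 ?posrE.
rewrite expr_div_n ler_pdivrMr ?exprn_gt0//.
by rewrite -!natrX -natrM ler_nat expn_le_bin.
Qed.

(** With [m] about [3 / 10 * N] and [t] about [lam / 2], the exponent [5 / 4 * t * (t + 1) / m] of
    [bin_off_center_ge] is about [L / 6]; the slack up to [7 / 40 * L + 5 / 2] absorbs the rounding.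
    The bound on [L] keeps [t] within [11 / 20 * m]. *)
Lemma off_center_bin_ge (R : realType) (N m t : nat) (lam L : R) :
  1000 <= N%:R :> R -> (0 < m)%N -> (2 * m <= N)%N -> 299 / 1000 * N%:R <= m%:R :> R ->
  0 <= L -> L <= 5 / 8 * N%:R -> 0 <= lam -> lam ^+ 2 = 4 / 25 * (N%:R * L) ->
  t%:R <= lam / 2 + 1 ->
  (t <= m)%N /\
  expR (- (7 / 40 * L + 3 + ln N%:R / 2)) <= 'C(2 * m, m - t)%:R / 4 ^+ m.
Proof.
move=> N1 m0 mN mlo L0 L1 lam0 lam2 tle.
have NL : N%:R * L <= N%:R * (5 / 8 * N%:R) by rewrite ler_wpM2l//; lra.
have lamle : lam <= 317 / 1000 * N%:R.
  rewrite -(@ler_pXn2r _ 2) ?nnegrE//; last by lra.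
  have NN0 : 0 <= N%:R * N%:R :> R by rewrite mulr_ge0.
  by rewrite lam2 expr2; lra.
have tm55 : t%:R <= 11 / 20 * m%:R :> R by lra.
split; first by rewrite -(ler_nat R); lra.
rewrite ler_pdivlMr ?exprn_gt0//; apply: le_trans (bin_off_center_ge m0 tm55).
have mR : 0 < m%:R :> R by rewrite ltr0n.
have tt : (t * t.+1)%:R <= 1 / 25 * (N%:R * L) + 3 / 2 * lam + 2 :> R.
  rewrite natrM -natr1.
  apply: (@le_trans _ _ ((lam / 2 + 1) * (lam / 2 + 2))).
    by apply: ler_pM; rewrite ?addr_ge0//; lra.
  by move: lam2; rewrite expr2; lra.
have tail : 5 / 4 * (t * t.+1)%:R / m%:R <= 7 / 40 * L + 5 / 2 :> R.
  rewrite ler_pdivrMr//.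
  apply: (@le_trans _ _ ((7 / 40 * L + 5 / 2) * (299 / 1000 * N%:R))); last first.
    by rewrite ler_wpM2l//; lra.
  have NL0 : 0 <= N%:R * L by rewrite mulr_ge0.
  by lra.
apply: (@le_trans _ _ (expR (- ((ln N%:R + 1) / 2)) * 4 ^+ m *
    expR (- (5 / 4 * (t * t.+1)%:R / m%:R)))).
  by rewrite [leRHS]mulrAC -expRD ler_wpM2r ?exprn_ge0// ler_expR; lra.
by rewrite ler_wpM2r ?expR_ge0// central_bin_expR.
Qed.

(** The logarithm of the number of shift sets is at least [(k - 1) * w], and that of the tail
    probability at least [- (7 / 40 * L + 3 + ln N / 2)] with [L <= k * (11 / 4 + w)];
    [exponent_estimate] compares the two. *)
Lemma lower_tail_estimate (R : realType) (N F k : nat) (m := ((3 * N) %/ 10)%N)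
    (lam : R := 2 / 5 * typical_size R N k F) (t := (Num.truncn (lam / 2)).+1) :
  300 <= ln N%:R :> R -> (2 <= F)%N -> (2 <= k)%N -> (6 * k <= N)%N ->
  6 * k%:R * ln F%:R <= N%:R * ln 2 :> R ->
  [/\ (0 < m)%N && (2 * m <= N)%N, (t <= m)%N, lam < (2 * t)%:R,
      (k.-1 <= F.-1 * (N - 2 * m).+1)%N &
   ('C(F.-1 * (N - 2 * m).+1, k.-1)%:R * ('C(2 * m, m - t)%:R / 4 ^+ m))^-1 <=
   expR (16 - ln N%:R / 10 - k%:R / 20) :> R].
Proof.
move=> l300 F2 k2 kN kF.
set l := ln N%:R in l300 *.
have k0 : (0 < k)%N by exact: ltnW.
have N0 : (0 < N)%N by lia.
have NR : 0 < N%:R :> R by rewrite ltr0n.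
have N1 : 1000 <= N%:R :> R.
  have l0 : 0 <= l by lra.
  have h : l ^+ 2 / 2 <= N%:R.
    rewrite -[leRHS]lnK ?posrE//.
    have := expR_ge1Dxn 1 l0; have -> : 2`! = 2%N by [].
    by apply: le_trans; lra.
  have h' : 300 * l <= l * l by rewrite ler_wpM2r.
  by move: h; rewrite expr2; lra.
have [m0 m3 mlo] := block_length_bounds R (etrans (esym (ler_nat R 1000 N)) N1).
rewrite -/m in m0 m3 mlo.
have mN : (2 * m <= N)%N by clear -m3; lia.
set L := log_count R N k F.
have L0 : 0 <= L := log_count_ge0 R N k F.
have L1 : L <= 5 / 8 * N%:R by exact: log_count_le_linear.
have lam0 : 0 <= lam by rewrite /lam mulr_ge0 ?typical_size_ge0//; lra.
have lam2 : lam ^+ 2 = 4 / 25 * (N%:R * L).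
  by rewrite /lam exprMn typical_size_sqr -/L; congr *%R; field.
have tlt : lam < (2 * t)%:R by rewrite natrM; have := truncnS_gt (lam / 2); rewrite -/t; lra.
have tle : t%:R <= lam / 2 + 1.
  by rewrite /t -natr1 lerD2r; have /andP[] := @truncn_itv R (lam / 2) (divr_ge0 lam0 (ler0n _ _)).
clearbody t; clearbody lam m.
have [tm hp] := off_center_bin_ge N1 m0 mN mlo L0 L1 lam0 lam2 tle.
have [kQ hK] := bin_shifts_ge R F2 k2 kN m3.
split=> //; first by rewrite m0 mN.
set Q := (F.-1 * _)%N in kQ hK *.
rewrite -/l in hp.
clearbody Q; clear N1 m3 mlo tle tlt lam0 lam2 L0 L1.
have kN' : (0 < k <= N)%N by rewrite k0 (leq_trans _ kN)// leq_pmull.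
have F0 : (0 < F)%N by exact: ltnW.
set w := ln (F%:R * N%:R / (5 * k%:R)) : R.
have kR : 0 < k%:R :> R by rewrite ltr0n.
have k2R : 2 <= k%:R :> R by rewrite ler_nat.
have FR : 2 <= F%:R :> R by rewrite ler_nat.
have kNR : 6 * k%:R <= N%:R :> R by rewrite -natrM ler_nat.
have FNlo : 2 * N%:R <= F%:R * N%:R :> R by rewrite ler_wpM2r// ltW.
have w34 : 3 / 4 <= w.
  have [_ _ /andP[h _]] := ln_constants R; apply: (le_trans h).
  have d0 : 0 < F%:R * N%:R / (5 * k%:R) :> R by rewrite divr_gt0 ?mulr_gt0//; lra.
  rewrite ler_ln ?posrE//; last by lra.
  by rewrite ler_pdivlMr ?mulr_gt0//; lra.
have wl : l - ln k%:R - 1 <= w.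
  have [_ _ /andP[_ h]] := ln_constants R.
  apply: (@le_trans _ _ (l - ln k%:R - ln (5 / 2))).
    rewrite lerD2l lerN2; apply: ln_le_of_expR; first by lra.
    by have [_ ? _] := expR_numeric_bounds R.
  rewrite /l -ln_div ?posrE// -ln_div ?posrE ?divr_gt0//.
  have k5 : 0 < 5 * k%:R :> R by rewrite mulr_gt0.
  rewrite ler_ln ?posrE ?divr_gt0 ?mulr_gt0//; try lra.
  have -> : N%:R / k%:R / (5 / 2) = 2 * N%:R / (5 * k%:R) :> R by field; rewrite gt_eqF.
  by rewrite ler_pM2r ?invr_gt0.
have {}hK : expR ((k%:R - 1) * w) <= 'C(Q, k.-1)%:R.
  have -> : k%:R - 1 = k.-1%:R :> R by rewrite -[in LHS](prednK k0) -natr1 addrK.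
  by rewrite expRM_natl lnK// posrE divr_gt0 ?mulr_gt0//; lra.
have Lk : L <= k%:R * (11 / 4 + w) by exact: log_count_le_mul.
clearbody L w.
have hKp : expR ((k%:R - 1) * w - (7 / 40 * L + 3 + l / 2)) <=
    'C(Q, k.-1)%:R * ('C(2 * m, m - t)%:R / 4 ^+ m).
  by rewrite expRD; apply: ler_pM; rewrite ?expR_ge0.
have -> : expR (16 - l / 10 - k%:R / 20) = (expR (l / 10 + k%:R / 20 - 16))^-1.
  by rewrite -expRN; congr expR; ring.
rewrite lef_pV2 ?posrE ?expR_gt0//; last by apply: lt_le_trans hKp; rewrite expR_gt0.
apply: le_trans hKp; rewrite ler_expR.
have h := exponent_estimate l300 k2R w34 wl; lra.
Qed.

(** The square of [5 / 2] times the typical size, over [2 * N], is [25 / 8 * L]; against it stand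
    [k * ln F + 2 * ln 'C(N, k)] from the number of sets.  What remains is at most
    [- 9 / 8 * ln 'C(N, 2)], and ['C(N, 2)] is at least [N ^ 2 / 4]. *)
Lemma upper_tail_estimate (R : realType) (N F k : nat) :
  (0 < F)%N -> (2 <= k)%N -> (6 * k <= N)%N ->
  N%:R * 'C(F * N, k)%:R *
    (2 * expR (- ((5 / 2 * typical_size R N k F) ^+ 2 / (2 * N%:R)))) <=
  expR (3 - 5 / 4 * ln N%:R) :> R.
Proof.
move=> F0 k2 kN.
have k0 : (0 < k)%N by exact: ltnW.
have kN' : (k <= N)%N by rewrite (leq_trans _ kN)// leq_pmull.
have N2 := leq_trans k2 kN'.
have N0 : (0 < N)%N by exact: ltnW.
have NR : 0 < N%:R :> R by rewrite ltr0n.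
have FR : 0 < F%:R :> R by rewrite ltr0n.
have bR : 0 < 'C(N, k)%:R :> R by rewrite ltr0n bin_gt0.
have b2R : 0 < 'C(N, 2)%:R :> R by rewrite ltr0n bin_gt0.
set b := ln 'C(N, k)%:R : R; set f := k%:R * ln F%:R : R; set l := ln N%:R : R.
have f0 : 0 <= f by rewrite mulr_ge0// ln_natr_ge0.
have hb : 'C(F * N, k)%:R <= expR (f + 2 * b).
  apply: (@le_trans _ _ ((F ^ k * 'C(N, k) ^ 2)%:R)); first by rewrite ler_nat bin_mul_le.
  by rewrite natrM !natrX expRD /f /b !expRM_natl !lnK ?posrE.
have e : (5 / 2 * typical_size R N k F) ^+ 2 / (2 * N%:R) = 25 / 8 * (b + f).
  by rewrite exprMn typical_size_sqr /log_count -/b -/f; field; rewrite gt_eqF.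
have [h2 _ _] := ln_constants R.
have b2 : 2 * l - 2 * ln 2 <= b.
  apply: (@le_trans _ _ (ln 'C(N, 2)%:R)); last first.
    rewrite ler_ln ?posrE// ler_nat bin2_le_bin//.
    by apply: leq_trans kN; rewrite leq_mul2r orbT.
  rewrite lerBlDr; have := expn_le_bin N2; rewrite -(ler_nat R) natrM !natrX => h.
  have eN : ln (N%:R ^+ 2) = 2 * l by rewrite lnXn// mulr_natl.
  have e2 : ln (2 ^+ 2) = 2 * ln 2 :> R by rewrite lnXn// mulr_natl.
  have p2 : 0 < 2 ^+ 2 :> R by rewrite exprn_gt0.
  rewrite -eN -e2 -(lnM (x := 'C(N, 2)%:R)) ?posrE//.
  by rewrite ler_ln ?posrE ?mulr_gt0// exprn_gt0.
rewrite e; set E := expR (- _).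
have -> : N%:R * 'C(F * N, k)%:R * (2 * E) = (2 * N%:R) * ('C(F * N, k)%:R * E) by ring.
apply: (@le_trans _ _ (expR (3 / 4) * expR l * (expR (f + 2 * b) * E))).
  apply: ler_pM; rewrite ?mulr_ge0 ?expR_ge0//.
    rewrite /l lnK ?posrE// ler_wpM2r ?(ltW NR)//.
    by have [] := expR_numeric_bounds R.
  by rewrite ler_wpM2r ?expR_ge0.
by rewrite /E -!expRD ler_expR; lra.
Qed.

Lemma sum_expR_geometric_le (R : realType) (n : nat) :
  \sum_(k < n) expR (- (k%:R / 20)) <= 21 :> R.
Proof.
pose q : R := expR (- (1 / 20)).
have q0 : 0 <= q by exact: expR_ge0.
have q1 : q <= 20 / 21.
  rewrite /q expRN invf_ple ?posrE ?expR_gt0//; try lra.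
  by apply: le_trans (expR_ge1Dx _); lra.
have -> : \sum_(k < n) expR (- (k%:R / 20)) = \sum_(k < n) q ^+ k.
  by apply: eq_bigr => k _; rewrite /q -expRM_natl; congr expR; ring.
have h := subrX1 q n.
have qn : 0 <= q ^+ n by rewrite exprn_ge0.
set s := \sum_(_ < _) _ in h *.
have s0 : 0 <= s by rewrite sumr_ge0// => i _; rewrite exprn_ge0.
have : (1 - 20 / 21) * s <= (1 - q) * s by rewrite ler_wpM2r//; lra.
lra.
Qed.

Lemma Phi_between (R : realType) (N F k m : nat) (w : config F N)
    (j0 : 'I_F) (i0 : 'I_N) (lam mu : R) :
  (0 < k)%N -> (0 < m)%N -> (m <= N)%N -> i0 = 0%N :> nat -> 0 < mu -> injective (seqs w) ->
  w \notin has_large_sum F N k mu -> w \notin no_large_sum k.-1 j0 i0 m lam ->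
  lam < (Phi (seqs w @: setT) k)%:R /\ (Phi (seqs w @: setT) k)%:R < mu.
Proof.
move=> k0 m0 mN i00 mu0 winj; rewrite !inE => no_large; rewrite negb_forall => /existsP[A].
rewrite negb_imply -ltNge => /andP[/andP[/fintype.subsetP sA /eqP cA] lamA]; split.
  apply: (lt_le_trans lamA).
  apply: (@le_trans _ _ (`|signsum (shifted_sums ((j0, i0) |: A) m w)|%N%:R)).
    by rewrite natr_absz ler_int ler_norm.
  rewrite ler_nat; apply: signsum_le_Phi => //.
    rewrite cardsU1 cA; have -> : (j0, i0) \notin A; last by rewrite add1n prednK.
    by apply/negP => /sA; rewrite inE eqxx.
  apply/forall_inP => p; rewrite !inE => /predU1P[->|/sA]; first by rewrite /= i00 addn0.
  by rewrite inE => /andP[].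
apply: Phi_lt => // M B /andP[M0 MN] cB fB; rewrite ltNge; apply/negP => large.
have MN' : (M < N.+1)%N by rewrite ltnS.
move/negP: no_large; apply; apply/existsP; exists (Ordinal MN'); apply/existsP; exists B.
by rewrite M0 cB eqxx fB.
Qed.

Lemma card_has_large_sum_typical (R : realType) (N F k : nat) :
  (0 < F)%N -> (2 <= k)%N -> (6 * k <= N)%N ->
  #|has_large_sum F N k (5 / 2 * typical_size R N k F)|%:R <=
  expR (3 - 5 / 4 * ln N%:R) * #|{: config F N}|%:R :> R.
Proof.
move=> F0 k2 kN; have k0 : (0 < k)%N by exact: ltnW.
have est := upper_tail_estimate R F0 k2 kN.
have lam0 : 0 <= 5 / 2 * typical_size R N k F by rewrite mulr_ge0 ?divr_ge0 ?typical_size_ge0.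
move: est lam0; set lam := 5 / 2 * typical_size _ _ _ _; clearbody lam => est lam0.
apply: (le_trans (card_has_large_sum F N k0 lam0)).
by rewrite ler_wpM2r.
Qed.

Lemma card_no_large_sum_typical (R : realType) (N F k : nat) (j0 : 'I_F) (i0 : 'I_N) :
  i0 = 0%N :> nat -> 300 <= ln N%:R :> R -> (2 <= F)%N -> (2 <= k)%N -> (6 * k <= N)%N ->
  6 * k%:R * ln F%:R <= N%:R * ln 2 :> R ->
  (0 < 2 * ((3 * N) %/ 10) <= N)%N /\
  #|no_large_sum k.-1 j0 i0 (2 * ((3 * N) %/ 10)) (2 / 5 * typical_size R N k F)|%:R <=
  expR (16 - ln N%:R / 10 - k%:R / 20) * #|{: config F N}|%:R :> R.
Proof.
move=> i00 l300 F2 k2 kN kF.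
have [/andP[m0 mN] tm lamt kQ est] := lower_tail_estimate l300 F2 k2 kN kF.
split; first by rewrite mN muln_gt0 m0.
apply: (le_trans (card_no_large_sum j0 i00 m0 mN tm lamt kQ)).
by rewrite mulrC ler_wpM2r.
Qed.

(** * The typical order of the cross-correlation measure *)

Lemma log2_ge1 (R : realType) (F : nat) : 1 <= log2 (F%:R : R) -> (2 <= F)%N.
Proof.
have ln2 : 0 < ln 2 :> R by rewrite ln_gt0//; lra.
rewrite /log2 ler_pdivlMr// mul1r => h.
have F0 : (0 < F)%N by case: F h => [|//]; rewrite mulr0n (ln0 (lexx 0)) leNgt ln2.
by move: h; rewrite ler_ln ?posrE ?ltr0n// ler_nat.
Qed.

(** The hypothesis says [F ^ 12 < 2 ^ N]. *)
Lemma log2_lt_expn (R : realType) (N F : nat) : (2 <= F)%N ->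
  log2 (F%:R : R) < N%:R / 12 -> (2 * F ^ 2 <= 2 ^ N)%N.
Proof.
move=> F2 h; have ln2 : 0 < ln 2 :> R by rewrite ln_gt0//; lra.
have FR : 0 < F%:R :> R by rewrite ltr0n; exact: ltnW.
have h12 : (F ^ 12 < 2 ^ N)%N.
  rewrite -(ltr_nat R) !natrX -ltr_ln ?posrE ?exprn_gt0// !lnXn//.
  rewrite -[ltLHS]mulr_natr -[ltRHS]mulr_natr.
  by move: h; rewrite /log2 ltr_pdivrMr//; lra.
apply: (@leq_trans (F ^ 12)); last exact: ltnW.
apply: (@leq_trans (F ^ 3)); last by rewrite leq_pexp2l//; exact: ltnW.
by rewrite [leqRHS]expnS leq_mul2r F2 orbT.
Qed.

Lemma order_le (R : realType) (N F k : nat) : 1 <= log2 (F%:R : R) ->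
  k%:R <= N%:R / (6 * log2 (F%:R : R)) ->
  (6 * k <= N)%N /\ 6 * k%:R * ln F%:R <= N%:R * ln 2 :> R.
Proof.
move=> F1; have ln2 : 0 < ln 2 :> R by rewrite ln_gt0//; lra.
rewrite ler_pdivlMr; last by rewrite mulr_gt0//; lra.
move=> h; split.
  rewrite -(ler_nat R) natrM; apply: le_trans h.
  rewrite mulrCA ler_wpM2l//; have := ler0n R k => k0.
  by rewrite -[leLHS]mulr1 ler_wpM2l.
have -> : 6 * k%:R * ln F%:R = k%:R * (6 * log2 F%:R) * ln 2 :> R.
  by rewrite /log2; field; rewrite gt_eqF.
by rewrite ler_wpM2r// ltW.
Qed.

Lemma total_failure_le (R : realType) (eps l : R) (N : nat) : 0 < eps -> l = ln N%:R ->
  300 <= l -> 10 * (21 - ln eps) <= l ->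
  2 * \sum_(k < N.+1) (expR (3 - 5 / 4 * l) + expR (16 - l / 10 - k%:R / 20)) <= eps.
Proof.
move=> eps0 lE l300 leps.
have N0 : (0 < N)%N by case: N lE => // lE; move: l300; rewrite lE mulr0n (ln0 (lexx 0)); lra.
have NR : N%:R = expR l by rewrite lE lnK// posrE ltr0n.
rewrite big_split/= sumr_const card_ord -[_ *+ _]mulr_natl.
have h1 : N.+1%:R * expR (3 - 5 / 4 * l) <= 2 * expR (16 - l / 10).
  apply: (@le_trans _ _ (2 * N%:R * expR (3 - 5 / 4 * l))).
    rewrite ler_wpM2r ?expR_ge0// -natrM ler_nat; lia.
  by rewrite NR -mulrA -expRD ler_wpM2l// ler_expR; lra.
have h2 : \sum_(k < N.+1) expR (16 - l / 10 - k%:R / 20) <= 21 * expR (16 - l / 10).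
  under eq_bigr do rewrite expRD.
  by rewrite -mulr_sumr mulrC ler_wpM2r ?expR_ge0// sum_expR_geometric_le.
have h3 : 46 * expR (16 - l / 10) <= eps.
  rewrite -[leRHS]lnK ?posrE//; apply: (@le_trans _ _ (expR 5 * expR (16 - l / 10))).
    rewrite ler_wpM2r ?expR_ge0//; have [_ h _] := expR_numeric_bounds R.
    have -> : expR 5 = expR 1 ^+ 5 :> R by rewrite -expRM_natl; congr expR; ring.
    apply: (@le_trans _ _ ((5 / 2) ^+ 5)); first by lra.
    by apply: lerXn2r; rewrite ?nnegrE ?expR_ge0//; lra.
  by rewrite -expRD ler_expR; lra.
by lra.
Qed.

Theorem theorem2 (R : realType) (eps : R) (eps_gt0 : 0 < eps) :
  exists N0 : nat, forall N F : nat,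
    (N0 < N)%N ->
    1 <= log2 (F%:R : R) ->
    log2 (F%:R : R) < N%:R / 12 ->
    1 - eps <=
    uniform_prob R [set Fam : {set binseq N} | #|Fam| == F]
      (fun Fam : {set binseq N} =>
         forall k : nat,
           (2 <= k)%N ->
           (k%:R : R) <= N%:R / (6 * log2 (#|Fam|%:R : R)) ->
           2 / 5 * typical_size R N k #|Fam| < (Phi Fam k)%:R /\
           (Phi Fam k)%:R < 5 / 2 * typical_size R N k #|Fam|).
Proof.
(* [300] suits [exponent_estimate]; the other bound makes the total failure probability small. *)
pose l0 : R := Num.max 300 (10 * (21 - ln eps)).
exists (Num.bound (expR l0)) => N F N0N F1 F12.
have NE : expR l0 <= N%:R.
  by apply: (le_trans (ltW (archi_boundP (expR_ge0 l0)))); rewrite ler_nat ltnW.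
have NR : 0 < N%:R :> R by apply: lt_le_trans NE; rewrite expR_gt0.
have lN : l0 <= ln N%:R by rewrite -ler_expR lnK.
have l300 : 300 <= ln N%:R :> R by apply: le_trans lN; rewrite le_max lexx.
have leps : 10 * (21 - ln eps) <= ln N%:R by apply: le_trans lN; rewrite le_max lexx orbT.
have F2 := log2_ge1 F1.
have F0 : (0 < F)%N by exact: ltnW.
have NN : (0 < N)%N by rewrite -(ltr_nat R).
pose j0 : 'I_F := Ordinal F0; pose i0 : 'I_N := Ordinal NN.
pose m := ((3 * N) %/ 10)%N.
pose valid k := (2 <= k)%N && (k%:R <= N%:R / (6 * log2 (F%:R : R))).
pose bad k : {set config F N} := has_large_sum F N k (5 / 2 * typical_size R N k F) :|:
   no_large_sum k.-1 j0 i0 (2 * m) (2 / 5 * typical_size R N k F).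
have card_bad k : valid k -> #|bad k|%:R <=
    (expR (3 - 5 / 4 * ln N%:R) + expR (16 - ln N%:R / 10 - k%:R / 20)) * #|{: config F N}|%:R :> R.
  move=> /andP[k2 /(order_le F1)[kN kF]].
  have k0 : (0 < k)%N by exact: ltnW.
  apply: (@le_trans _ _ (#|has_large_sum F N k (5 / 2 * typical_size R N k F)|%:R +
      #|no_large_sum k.-1 j0 i0 (2 * m) (2 / 5 * typical_size R N k F)|%:R)).
    by rewrite -natrD ler_nat /bad cardsU leq_subr.
  rewrite [leRHS]mulrDl; apply: lerD.
    exact: card_has_large_sum_typical.
  by have [_] := card_no_large_sum_typical j0 (i0 := i0) erefl l300 F2 k2 kN kF.
pose badU := \bigcup_(k < N.+1 | valid k) bad k.
apply: (@le_trans _ _ (1 - 2 * (#|badU|%:R / #|{: config F N}|%:R))).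
  rewrite lerD2l lerN2; apply: le_trans (total_failure_le eps_gt0 erefl l300 leps).
  have W0 : 0 < #|{: config F N}|%:R :> R by rewrite card_config ltr0n !expn_gt0.
  rewrite ler_wpM2l// ler_pdivrMr// mulr_suml.
  apply: (@le_trans _ _ (\sum_(k < N.+1 | valid k) #|bad k|%:R)).
    by rewrite -natr_sum ler_nat card_bigcup_le.
  rewrite [leRHS](bigID (fun k : 'I_N.+1 => valid k))/= -[leLHS]addr0; apply: lerD.
    by apply: ler_sum => k; exact: card_bad.
  by apply: sumr_ge0 => k _; rewrite mulr_ge0// addr_ge0 ?expR_ge0.
apply: uniform_prob_ge; first exact: log2_lt_expn F12.
move=> w winj; apply: contra_notT => good k k2.
rewrite card_imset// cardsT card_ord => kF.
have [kN kF'] := order_le F1 kF.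
have kN1 : (k < N.+1)%N by rewrite ltnS (leq_trans _ kN)// leq_pmull.
have k0 : (0 < k)%N by exact: ltnW.
have : w \notin bad k.
  apply: contra good => wk; apply/bigcupP; exists (Ordinal kN1) => //.
  by rewrite /valid k2.
rewrite inE negb_or => /andP[no_large not_small].
have [/andP[m0 mN] _] := card_no_large_sum_typical j0 (i0 := i0) erefl l300 F2 k2 kN kF'.
apply: (Phi_between k0 m0 mN (i0 := i0) erefl _ winj no_large not_small).
rewrite mulr_gt0 ?divr_gt0// /typical_size sqrtr_gt0 mulr_gt0// ltr_wpDl ?ln_natr_ge0//.
by rewrite mulr_gt0 ?ltr0n// ln_gt0// ltr1n.
Qed.
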